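(* A $3$-quasi-Sasakian manifold $(M,\phi_\alpha,\xi_\alpha,\eta_\alpha,g)$, $\alpha\in\{1,2,3\}$, is Ricci-flat if and only if it is $3$-cosymplectic.
   Context: Conventions: for a $1$-form $\eta$, $2d\eta(X,Y)=X(\eta(Y))-Y(\eta(X))-\eta([X,Y])$. An almost contact metric structure $(\phi,\xi,\eta,g)$ consists of a $(1,1)$-tensor $\phi$, a vector field $\xi$, a $1$-form $\eta$ and a Riemannian metric $g$ with $\phi^2=-I+\eta\otimes\xi$, $\eta(\xi)=1$, $g(\phi X,\phi Y)=g(X,Y)-\eta(X)\eta(Y)$. Its fundamental $2$-form is $\Phi(X,Y)=g(X,\phi Y)$. It is normal if $[\phi,\phi]+2d\eta\otimes\xi=0$ ($[\phi,\phi]$ the Nijenhuis torsion), quasi-Sasakian if it is normal and $d\Phi=0$, and cosymplectic if it is normal, $d\Phi=0$ and $d\eta=0$. Only quasi-Sasakian structures of constant rank are considered, where the rank is $2p+1$ if $\eta\wedge(d\eta)^p\neq0$ and $(d\eta)^{p+1}=0$ on $M$. An almost $3$-contact metric manifold is a $(4n+3)$-dimensional manifold with three almost contact metric structures $(\phi_\alpha,\xi_\alpha,\eta_\alpha,g)$, $\alpha=1,2,3$, with the same metric $g$, such that for every even permutation $(\alpha,\beta,\gamma)$ of $\{1,2,3\}$: $\phi_\gamma=\phi_\alpha\phi_\beta-\eta_\beta\otimes\xi_\alpha=-\phi_\beta\phi_\alpha+\eta_\alpha\otimes\xi_\beta$, $\xi_\gamma=\phi_\alpha\xi_\beta=-\phi_\beta\xi_\alpha$,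 $\eta_\gamma=\eta_\alpha\circ\phi_\beta=-\eta_\beta\circ\phi_\alpha$. It is $3$-quasi-Sasakian (respectively $3$-cosymplectic) if each of the three structures is quasi-Sasakian (respectively cosymplectic). *)

(* Defs.v *)
From mathcomp Require Import all_boot all_order all_algebra all_fingroup.
From mathcomp Require Import all_classical all_reals all_analysis.
Import Order.TTheory GRing.Theory Num.Theory.
Import numFieldNormedType.Exports.

Set Implicit Arguments.
Unset Strict Implicit.
Unset Printing Implicit Defensive.

Local Open Scope classical_set_scope.
Local Open Scope ring_scope.

(* Tensor fields on a manifold are given by their components in every chart,
   subject to the transformation law under change of chart.  Dimensions are
   written m.+1 because 'rV[R]_m.+1 carries the normed module structure.
   Tangent vectors are row vectors, so matrices act on the right. *)

Section Smooth.
Variables (R : realType) (V W : normedModType R).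

(* For U open this is the usual C^k: f and its iterated directional
   derivatives up to order k exist and are continuous on U. *)
Fixpoint Ck (k : nat) (U : set V) (f : V -> W) : Prop :=
  (forall x, U x -> {for x, continuous f}) /\
  match k with
  | 0%N => True
  | k'.+1 => forall v : V,
      (forall x, U x -> derivable f x v) /\ Ck k' U (fun x => 'D_v f x)
  end.

Definition smooth_on (U : set V) (f : V -> W) : Prop := forall k, Ck k U f.

End Smooth.

(* dom i is the domain of chart i, crd i its coordinate map and par i the
   inverse of crd i. *)
Record smooth_manifold (R : realType) (m : nat) := SmoothManifold {
  carrier : topologicalType;
  carrier_hausdorff : hausdorff_space carrier;
  carrier_second_countable : @second_countable carrier;
  chart : Type;
  dom : chart -> set carrier;
  crd : chart -> carrier -> 'rV[R]_m.+1;
  par : chart -> 'rV[R]_m.+1 -> carrier;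
  dom_open : forall i, open (dom i);
  dom_cover : forall p, exists i, dom i p;
  img_open : forall i, open (crd i @` dom i);
  crdK : forall i p, dom i p -> par i (crd i p) = p;
  crd_continuous : forall i p, dom i p -> {for p, continuous (crd i)};
  par_continuous : forall i x, (crd i @` dom i) x -> {for x, continuous (par i)};
  transition_smooth : forall i j,
    smooth_on (crd i @` (dom i `&` dom j)) (crd j \o par i)
}.

Section Tensors.
Variables (R : realType) (m : nat) (M : smooth_manifold R m).
Notation V := 'rV[R]_m.+1.

Definition img (i : chart M) : set V := crd i @` dom i.
Definition overlap (i j : chart M) : set V := crd i @` (dom i `&` dom j).
Definition transition (i j : chart M) : V -> V := crd j \o par i.
Definition dtransition (i j : chart M) (x v : V) : V := 'D_v (transition i j) x.

Definition app1 (eta : 'cV[R]_m.+1) (u : V) : R := (u *m eta) 0 0.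
Definition app2 (g : 'M[R]_m.+1) (u v : V) : R := (u *m g *m v^T) 0 0.

Record vector_field := VectorField {
  vf_at :> chart M -> V -> V;
  vf_smooth : forall i, smooth_on (img i) (vf_at i);
  vf_compat : forall i j x, overlap i j x ->
    vf_at j (transition i j x) = dtransition i j x (vf_at i x)
}.

Record one_form := OneForm {
  of_at :> chart M -> V -> 'cV[R]_m.+1;
  of_smooth : forall i, smooth_on (img i) (of_at i);
  of_compat : forall i j x v, overlap i j x ->
    app1 (of_at j (transition i j x)) (dtransition i j x v) = app1 (of_at i x) v
}.

Record endo_field := EndoField {
  ef_at :> chart M -> V -> 'M[R]_m.+1;
  ef_smooth : forall i, smooth_on (img i) (ef_at i);
  ef_compat : forall i j x v, overlap i j x ->
    dtransition i j x v *m ef_at j (transition i j x) =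
    dtransition i j x (v *m ef_at i x)
}.

Record riemannian_metric := RiemannianMetric {
  rm_at :> chart M -> V -> 'M[R]_m.+1;
  rm_smooth : forall i, smooth_on (img i) (rm_at i);
  rm_compat : forall i j x u v, overlap i j x ->
    app2 (rm_at j (transition i j x)) (dtransition i j x u) (dtransition i j x v)
    = app2 (rm_at i x) u v;
  rm_sym : forall i x u v, img i x -> app2 (rm_at i x) u v = app2 (rm_at i x) v u;
  rm_posdef : forall i x u, img i x -> u != 0 -> 0 < app2 (rm_at i x) u u
}.

End Tensors.

(* Calculus in one coordinate domain: X, Y, Z are vector fields there. *)
Section Local.
Variables (R : realType) (m : nat).
Notation V := 'rV[R]_m.+1.
Implicit Types (X Y Z : V -> V) (eta : V -> 'cV[R]_m.+1) (phi g : V -> 'M[R]_m.+1).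

Definition der (W : normedModType R) X (f : V -> W) : V -> W :=
  fun x => 'D_(X x) f x.

Definition lie X Y : V -> V := fun x => der X Y x - der Y X x.

Definition pair1 eta X : V -> R := fun x => app1 (eta x) (X x).
Definition pair2 g X Y : V -> R := fun x => app2 (g x) (X x) (Y x).
Definition endo phi X : V -> V := fun x => X x *m phi x.

Definition d1 eta X Y : V -> R := fun x =>
  2^-1 * (der X (pair1 eta Y) x - der Y (pair1 eta X) x - pair1 eta (lie X Y) x).

(* Same convention as d1: 3 dPhi(X,Y,Z) is the alternating sum below. *)
Definition d2 (Phi : (V -> V) -> (V -> V) -> V -> R) X Y Z : V -> R := fun x =>
  3^-1 * (der X (Phi Y Z) x + der Y (Phi Z X) x + der Z (Phi X Y) x
          - Phi (lie X Y) Z x - Phi (lie Y Z) X x - Phi (lie Z X) Y x).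

Definition fundamental_form g phi X Y : V -> R := pair2 g X (endo phi Y).

Definition nijenhuis phi X Y : V -> V := fun x =>
  endo phi (endo phi (lie X Y)) x + lie (endo phi X) (endo phi Y) x
  - endo phi (lie (endo phi X) Y) x - endo phi (lie X (endo phi Y)) x.

(* christoffel g x u v is the vector w with
   2 g(w, z) = (D_u g)(v, z) + (D_v g)(u, z) - (D_z g)(u, v) for all z. *)
Definition christoffel g (x u v : V) : V :=
  (\row_k (2^-1 * (app2 ('D_u g x) v (delta_mx 0 k)
                   + app2 ('D_v g x) u (delta_mx 0 k)
                   - app2 ('D_(delta_mx 0 k) g x) u v))) *m invmx (g x).

Definition levi_civita g X Y : V -> V := fun x =>
  der X Y x + christoffel g x (X x) (Y x).

Definition curvature g X Y Z : V -> V := fun x =>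
  levi_civita g X (levi_civita g Y Z) x - levi_civita g Y (levi_civita g X Z) x
  - levi_civita g (lie X Y) Z x.

(* Tensors at a point x are evaluated on the constant extensions of their
   arguments; ricci g x u v is the trace of w |-> R(w, u) v. *)
Definition ricci g (x u v : V) : R :=
  \tr (lin1_mx (fun w : V => curvature g (cst w) (cst u) (cst v) x)).

(* Alternating k-linear forms on one tangent space, with the normalization of
   the wedge product that goes with the factors 1/2 and 1/3 in d1 and d2. *)
Definition kform (k : nat) := ('I_k -> V) -> R.

Definition wedge k l (a : kform k) (b : kform l) : kform (k + l) := fun v =>
  (((k + l)`!)%:R)^-1 * \sum_(s : 'S_(k + l))
    (-1) ^+ s * a (fun i => v (s (lshift l i))) * b (fun j => v (s (rshift k j))).

Fixpoint wedge_pow (a : kform 2) (p : nat) : kform (p * 2) :=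
  match p with
  | 0%N => fun _ => 1
  | p'.+1 => wedge a (@wedge_pow a p')
  end.

Definition eta_form eta (x : V) : kform 1 := fun v => app1 (eta x) (v ord0).
Definition deta_form eta (x : V) : kform 2 := fun v =>
  d1 eta (cst (v ord0)) (cst (v ord_max)) x.

End Local.

Arguments wedge_pow {R m} a p v.

Section AlmostContact.
Variables (R : realType) (m : nat) (M : smooth_manifold R m).
Notation V := 'rV[R]_m.+1.
Implicit Types (phi : endo_field M) (xi : vector_field M) (eta : one_form M)
  (g : riemannian_metric M).

Definition almost_contact_metric phi xi eta g : Prop :=
  forall (i : chart M) (x : V), img i x ->
  [/\ forall u, u *m phi i x *m phi i x = - u + app1 (eta i x) u *: xi i x,
      app1 (eta i x) (xi i x) = 1
    & forall u v, app2 (g i x) (u *m phi i x) (v *m phi i x)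
                  = app2 (g i x) u v - app1 (eta i x) u * app1 (eta i x) v].

Definition normal_structure phi xi eta : Prop :=
  forall (i : chart M) (X Y : V -> V),
  smooth_on (img i) X -> smooth_on (img i) Y -> forall x, img i x ->
  nijenhuis (phi i) X Y x + (2 * d1 (eta i) X Y x) *: xi i x = 0.

Definition closed_fundamental_form phi g : Prop :=
  forall (i : chart M) (X Y Z : V -> V),
  smooth_on (img i) X -> smooth_on (img i) Y -> smooth_on (img i) Z ->
  forall x, img i x -> d2 (fundamental_form (g i) (phi i)) X Y Z x = 0.

Definition closed_one_form eta : Prop :=
  forall (i : chart M) (X Y : V -> V),
  smooth_on (img i) X -> smooth_on (img i) Y ->
  forall x, img i x -> d1 (eta i) X Y x = 0.

(* Constant rank 2p+1: eta /\ (d eta)^p vanishes nowhere and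
   (d eta)^(p+1) vanishes identically. *)
Definition has_rank eta (p : nat) : Prop :=
  forall (i : chart M) (x : V), img i x ->
  (exists v, wedge (eta_form (eta i) x) (wedge_pow (deta_form (eta i) x) p) v != 0)
  /\ (forall v, wedge_pow (deta_form (eta i) x) p.+1 v = 0).

Definition quasi_sasakian phi xi eta g : Prop :=
  [/\ almost_contact_metric phi xi eta g, normal_structure phi xi eta,
      closed_fundamental_form phi g & exists p, has_rank eta p].

Definition cosymplectic phi xi eta g : Prop :=
  [/\ almost_contact_metric phi xi eta g, normal_structure phi xi eta,
      closed_fundamental_form phi g & closed_one_form eta].

Definition ricci_flat g : Prop :=
  forall (i : chart M) (x : V), img i x -> forall u v, ricci (g i) x u v = 0.

End AlmostContact.

(* The index set {1,2,3} is 'I_3 = {0,1,2}.  Matrices act on the right, so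
   phi_a (phi_b u) is u *m phi b i x *m phi a i x. *)
Section ThreeStructures.
Variables (R : realType) (n : nat) (M : smooth_manifold R (4 * n).+2).
Notation V := 'rV[R]_(4 * n).+3.
Variables (phi : 'I_3 -> endo_field M) (xi : 'I_3 -> vector_field M)
  (eta : 'I_3 -> one_form M) (g : riemannian_metric M).

Definition almost_3_contact_metric : Prop :=
  (forall a, almost_contact_metric (phi a) (xi a) (eta a) g) /\
  forall s : 'S_3, ~~ odd_perm s ->
  let a := s 0 in let b := s 1 in let c := s 2 in
  forall (i : chart M) (x : V), img i x ->
  [/\ forall u, u *m phi c i x
                = u *m phi b i x *m phi a i x - app1 (eta b i x) u *: xi a i x,
      forall u, u *m phi c i x
                = - (u *m phi a i x *m phi b i x) + app1 (eta a i x) u *: xi b i x,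
      xi c i x = xi b i x *m phi a i x /\ xi c i x = - (xi a i x *m phi b i x),
      forall u, app1 (eta c i x) u = app1 (eta a i x) (u *m phi b i x)
    & forall u, app1 (eta c i x) u = - app1 (eta b i x) (u *m phi a i x)].

Definition three_quasi_sasakian : Prop :=
  almost_3_contact_metric /\ forall a, quasi_sasakian (phi a) (xi a) (eta a) g.

Definition three_cosymplectic : Prop :=
  almost_3_contact_metric /\ forall a, cosymplectic (phi a) (xi a) (eta a) g.

End ThreeStructures.

(* Main.v *)
(* Let s(u,v) = g(nabla_u xi, v) and t(u;v,z) = g((nabla_u phi) v, z).  Normality
   and d Phi = 0, evaluated on constant fields of a chart, are linear relations
   between s and t.  They give t(phi u;v,z) + t(u;v,phi z) = - s(u,v) eta(z), hence
   nabla_xi xi = 0 and s skew, i.e. xi is a unit Killing field; if moreover d eta = 0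
   then s = 0 and t = 0, i.e. xi and phi are parallel.

   Ricci-flat implies cosymplectic: tracing the second derivatives of xi gives
   Ric(xi,xi) = - tr((nabla xi)^2) = |nabla xi|^2, so nabla xi = 0 and d eta = 0.

   Conversely, in the 3-cosymplectic case the curvature commutes with the three
   parallel phi_a and kills the xi_a.  Since phi_1 and phi_2 anticommute up to terms
   with values in the span of the xi_a, tr(R(u,v) phi_a) = 0, and the traced first
   Bianchi identity says that Ric(u, phi_a v) = Ric(v, phi_a u).  Combining this for
   phi_1, phi_2 and phi_3 = phi_1 phi_2 + ... forces Ric = 0, as for hyper-Kaehler
   metrics. *)

Require Import Defs.
From mathcomp Require Import all_boot all_order all_algebra all_fingroup.
From mathcomp Require Import all_classical all_reals all_analysis.
From mathcomp Require Import ring lra.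
Import Order.TTheory GRing.Theory Num.Theory.
Import numFieldNormedType.Exports.

Set Implicit Arguments.
Unset Strict Implicit.
Unset Printing Implicit Defensive.

Local Open Scope classical_set_scope.
Local Open Scope ring_scope.

(** * Directional derivatives *)

Section DirectionalDerivatives.
Variables (R : realType) (V : normedModType R).
Implicit Types (f : V -> R) (x y u v : V).

Lemma is_derive_line f y v (s : R) :
  derivable f (y + s *: v) v ->
  is_derive s 1 (fun t : R => f (y + t *: v)) ('D_v f (y + s *: v)).
Proof.
move=> df.
have E : (fun h : R => h^-1 *: (((fun t : R => f (y + t *: v)) \o shift s) (h *: 1) - f (y + s *: v)))
   = (fun h : R => h^-1 *: ((f \o shift (y + s *: v)) (h *: v) - f (y + s *: v))).
  apply/funext => h /=; congr (_ *: (f _ - _)).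
  by rewrite scalerDl /GRing.scale /= mulr1 addrCA addrA addrC addrA.
by split; rewrite ?/derivable ?/derive E.
Qed.

Lemma MVT_line f y v (h : R) : 0 < h ->
  (forall s, 0 <= s <= h -> derivable f (y + s *: v) v) ->
  exists2 s, 0 <= s <= h & f (y + h *: v) - f y = h * 'D_v f (y + s *: v).
Proof.
move=> h0 df.
have [s||s] := @MVT_segment R (fun t : R => f (y + t *: v)) (fun s => 'D_v f (y + s *: v)) 0 h (ltW h0).
- by rewrite in_itv/= => /andP[a b]; apply/is_derive_line/df; rewrite !ltW.
- apply: derivable_within_continuous => s; rewrite in_itv/= => sh.
  by have := is_derive_line (df s sh) => -[].
- rewrite in_itv/= => sh; rewrite scale0r addr0 subr0 mulrC => E.
  by exists s.
Qed.

(** The mean value theorem along [v] evaluates ['D_v f] at an intermediate point, where continuity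
    keeps it within [e] of ['D_v f x]. The bound is uniform in the base point [y], which is what
    additivity in the direction and symmetry of second derivatives rest on. *)
Lemma derive_strict f x v :
  (\forall y \near x, derivable f y v) -> {for x, continuous (fun y => 'D_v f y)} ->
  forall e : R, 0 < e -> exists2 d : R, 0 < d &
   forall y h, `|y - x| < d -> 0 < h < d ->
     `|f (y + h *: v) - f y - h * 'D_v f x| <= e * h.
Proof.
move=> df cf e e0.
have /nbhs_ballP[d1 /= d10 D1] := df.
have /cvgrPdist_le/(_ e e0)/nbhs_ballP[d2 /= d20 D2] := cf.
pose d3 := Num.min d1 d2.
have d30 : 0 < d3 by rewrite lt_min d10 d20.
have v0 : 0 < 1 + `|v| by rewrite ltr_pwDl.
(* Half of [d3] pays for the distance from [x] to [y], half for the displacement [s *: v]; the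
   summand [1] keeps the divisor positive when [v = 0]. *)
exists (d3 / 2 / (1 + `|v|)); first by rewrite !divr_gt0.
move=> y h yx /andP[h0 hd].
have B s : 0 <= s <= h -> `|x - (y + s *: v)| < d3.
  move=> /andP[s0 sh].
  rewrite opprD addrA (le_lt_trans (ler_normB _ _))// normrZ (ger0_norm s0).
  have : s * `|v| <= h * (1 + `|v|).
    by rewrite ler_pM// lerDr.
  have : h * (1 + `|v|) < d3 / 2 by rewrite -ltr_pdivlMr.
  have : `|x - y| < d3 / 2.
    rewrite distrC (lt_le_trans yx)// ler_pdivrMr// ler_peMr ?lerDl ?divr_ge0// ltW//.
  lra.
have [s sh|s sh ->] := @MVT_line f y v h h0.
  by apply: D1; rewrite -ball_normE/= (lt_le_trans (B s sh))// ge_min lexx.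
rewrite -mulrBr normrM (gtr0_norm h0) mulrC ler_pM2r// distrC.
by apply: D2; rewrite -ball_normE/= (lt_le_trans (B s sh))// ge_min lexx orbT.
Qed.

Lemma derive_approx f x v : derivable f x v ->
  forall e : R, 0 < e -> exists2 d : R, 0 < d &
   forall h, 0 < h < d -> `|f (x + h *: v) - f x - h * 'D_v f x| <= e * h.
Proof.
move=> df e e0.
have : (fun h => h^-1 *: ((f \o shift x) (h *: v) - f x)) @ 0^' --> 'D_v f x by exact: df.
move=> /cvgrPdist_le/(_ e e0)[d /= d0 D]; exists d => // h /andP[h0 hd].
have := D h; rewrite /ball_/= sub0r normrN (gtr0_norm h0) => /(_ hd (lt0r_neq0 h0)).
rewrite /= [h *: v + x]addrC; set a := f _ - f x => H.
have -> : a - h * 'D_v f x = - (h * ('D_v f x - h^-1 * a)).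
  by rewrite mulrBr mulrA divff ?gt_eqF// mul1r opprB.
by rewrite normrN normrM (gtr0_norm h0) mulrC ler_pM2r.
Qed.

(** Go from [x] to [x + h(u + v)] through [x + h v]. The second leg starts at a moving point and is
    estimated by [derive_strict] in direction [u]; the first leg and the diagonal are estimated by
    [derive_approx] at [x]. *)
Lemma deriveDv f x u v :
  (\forall y \near x, derivable f y u) -> {for x, continuous (fun y => 'D_u f y)} ->
  derivable f x v -> derivable f x (u + v) ->
  'D_(u + v) f x = 'D_u f x + 'D_v f x.
Proof.
move=> du cu dv duv.
have third : forall e : R, e / 3 + e / 3 + e / 3 = e by move=> e; field.
apply/eqP; rewrite -subr_eq0 -normr_le0; apply/ler_addgt0Pr => e e0.
have e3 : 0 < e / 3 by rewrite divr_gt0.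
have [d1 d10 D1] := derive_strict du cu e3.
have [d2 d20 D2] := derive_approx dv e3.
have [d3 d30 D3] := derive_approx duv e3.
have v0 : 0 < 1 + `|v| by rewrite ltr_pwDl.
pose d := Num.min (d1 / (1 + `|v|)) (Num.min d2 d3).
have d0 : 0 < d by rewrite !lt_min d20 d30 divr_gt0.
pose h := d / 2.
have h0 : 0 < h by rewrite divr_gt0.
have hd : h < d by rewrite /h ltr_pdivrMr// ltr_pMr// ltr1n.
have [h1 h2 h3] : [/\ h < d1 / (1 + `|v|), h < d2 & h < d3].
  by move: hd; rewrite !lt_min => /and3P.
have h1' : h < d1.
  by rewrite (lt_le_trans h1)// ler_pdivrMr// ler_peMr ?lerDl// ltW.
have := D1 (x + h *: v) h; rewrite addrAC subrr add0r normrZ (gtr0_norm h0).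
have hv : h * `|v| < d1.
  by move: h1; rewrite ltr_pdivlMr//; apply: le_lt_trans; rewrite ler_pM2l// lerDr.
move=> /(_ hv); rewrite h0 h1' => /(_ isT).
have := D2 h; rewrite h0 h2 => /(_ isT).
have := D3 h; rewrite h0 h3 => /(_ isT).
rewrite scalerDr addrA [x + h *: u + h *: v]addrAC.
set a := f (_ + _ + _); set b := f (_ + _); set c := f x => E3 E2 E1.
rewrite add0r -(ler_pM2r h0) -[X in _ * X <= _](gtr0_norm h0) -normrM.
have -> : ('D_(u + v) f x - ('D_u f x + 'D_v f x)) * h =
   (a - b - h * 'D_u f x) + (b - c - h * 'D_v f x) - (a - c - h * 'D_(u + v) f x) by ring.
rewrite (le_trans (ler_normB _ _))//.
rewrite (le_trans (lerD (ler_normD _ _) (lexx _)))//.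
by rewrite (le_trans (lerD (lerD E1 E2) E3))// -mulrDl -mulrDl third.
Qed.

Lemma deriveZv f x v (k : R) : derivable f x v -> derivable f x (k *: v) ->
  'D_(k *: v) f x = k * 'D_v f x.
Proof.
move=> dv dkv; pose g (t : R) := f (x + t *: v).
have E0 w : x = x + 0 *: w by rewrite scale0r addr0.
have dg : is_derive (0 : R) 1 g ('D_v f x).
  by have := @is_derive_line f x v 0; rewrite -E0; apply.
have dg' : is_derive (0 : R) 1 (g \o ( *:%R^~ k : R -> R)) ('D_(k *: v) f x).
  rewrite (_ : _ \o _ = fun t : R => f (x + t *: (k *: v))).
    by have := @is_derive_line f x (k *: v) 0; rewrite -E0; apply.
  by apply/funext => t /=; rewrite /g scalerA.
have dk : is_diff (0 : R) ( *:%R^~ k : R -> R) ( *:%R^~ k : R -> R).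
  exact: is_diff_scalel.
have -> : 'D_(k *: v) f x = derive1 (g \o ( *:%R^~ k : R -> R)) 0.
  by rewrite derive1E; apply/esym/(@derive_val _ _ _ _ _ _ _ dg').
rewrite derive1_comp.
- rewrite [X in _ * X]derive1E'; last by case: dk.
  rewrite scale0r diff_val scale1r derive1E mulrC; congr (_ * _).
  exact: (@derive_val _ _ _ _ _ _ _ dg).
- by apply: diff_derivable; case: dk.
- by rewrite scale0r; case: dg.
Qed.

(** The mean value theorem along [u], applied to the increment of [f] by [h v], turns the second
    difference into [h] times an increment of ['D_u f] along [v], which [derive_strict]
    estimates. *)
Lemma second_difference f x u v :
  (\forall y \near x, derivable f y u) ->
  (\forall y \near x, derivable ('D_u f) y v) ->
  {for x, continuous ('D_v ('D_u f))} ->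
  forall e : R, 0 < e -> exists2 d : R, 0 < d & forall h, 0 < h < d ->
  `|f (x + h *: u + h *: v) - f (x + h *: u) - f (x + h *: v) + f x
     - h ^+ 2 * 'D_v ('D_u f) x| <= e * h ^+ 2.
Proof.
move=> du dvu cvu e e0.
have [d1 d10 D1] := derive_strict dvu cvu e0.
have /nbhs_ballP[d2 /= d20 D2] := du.
have u0 : 0 < 1 + `|u| + `|v| by rewrite -addrA ltr_pwDl// addr_ge0.
pose d := Num.min d1 d2 / (1 + `|u| + `|v|).
have d0 : 0 < d by rewrite divr_gt0// lt_min d10 d20.
exists d => // h /andP[h0 hd].
have hm : h * (1 + `|u| + `|v|) < Num.min d1 d2 by rewrite -ltr_pdivlMr.
have hu0 : 0 <= h * `|u| by rewrite mulr_ge0// ltW.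
have hv0 : 0 <= h * `|v| by rewrite mulr_ge0// ltW.
have [hm1 hm2] : h * (1 + `|u| + `|v|) < d1 /\ h * (1 + `|u| + `|v|) < d2.
  by move: hm; rewrite lt_min => /andP.
have B s t : 0 <= s <= h -> 0 <= t <= h -> `|x - (x + s *: u + t *: v)| <= h * `|u| + h * `|v|.
  move=> /andP[s0 sh] /andP[t0 th].
  rewrite -addrA opprD addrA subrr add0r normrN (le_trans (ler_normD _ _))//.
  by rewrite !normrZ (ger0_norm s0) (ger0_norm t0) lerD// ler_wpM2r.
have D s t : 0 <= s <= h -> 0 <= t <= h -> derivable f (x + s *: u + t *: v) u.
  move=> sh th; apply: D2; rewrite -ball_normE/= (le_lt_trans (B s t sh th))//; lra.
have hh : 0 <= h <= h by rewrite lexx ltW.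
have h00 : 0 <= (0 : R) <= h by rewrite lexx ltW.
pose G (y : V) := f (y + h *: v) - f y.
have DG s : 0 <= s <= h -> is_derive (x + s *: u) u G
    ('D_u f (x + s *: u + h *: v) - 'D_u f (x + s *: u)).
  move=> sh.
  have D0 : derivable f (x + s *: u) u by have := D s 0 sh h00; rewrite scale0r addr0.
  apply: is_deriveB; last exact: derivableP.
  have E : (fun t : R => t^-1 *: (((fun y => f (y + h *: v)) \o shift (x + s *: u)) (t *: u)
      - f (x + s *: u + h *: v)))
    = (fun t : R => t^-1 *: ((f \o shift (x + s *: u + h *: v)) (t *: u)
      - f (x + s *: u + h *: v))).
    by apply/funext => t /=; rewrite !addrA.
  by split; rewrite ?/derivable ?/derive E//; exact: D.
have [|s sh E] := @MVT_line G x u h h0; first by move=> s /DG[].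
have -> : f (x + h *: u + h *: v) - f (x + h *: u) - f (x + h *: v) + f x = G (x + h *: u) - G x.
  by rewrite /G; ring.
rewrite E (@derive_val _ _ _ _ _ _ _ (DG s sh)).
have -> : forall a b c : R, h * (a - b) - h ^+ 2 * c = h * (a - b - h * c) by move=> *; ring.
rewrite normrM (gtr0_norm h0) expr2 mulrCA ler_pM2l//.
apply: D1; last by rewrite h0/=; apply: le_lt_trans hm1; lra.
rewrite addrC addKr normrZ.
case/andP: sh => s0 sh; rewrite ger0_norm//.
have : s * `|u| <= h * `|u| by rewrite ler_wpM2r.
lra.
Qed.

(** The second difference is unchanged when [u] and [v] are exchanged, so after division by [h ^+ 2]
    both mixed derivatives approximate the same number. *)
Lemma derive_commute f x u v :
  (\forall y \near x, derivable f y u) ->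
  (\forall y \near x, derivable f y v) ->
  (\forall y \near x, derivable ('D_u f) y v) ->
  (\forall y \near x, derivable ('D_v f) y u) ->
  {for x, continuous ('D_v ('D_u f))} ->
  {for x, continuous ('D_u ('D_v f))} ->
  'D_v ('D_u f) x = 'D_u ('D_v f) x.
Proof.
move=> du dv dvu duv cvu cuv.
apply/eqP; rewrite -subr_eq0 -normr_le0; apply/ler_addgt0Pr => e e0.
have e3 : 0 < e / 2 by rewrite divr_gt0.
have [d1 d10 D1] := second_difference du dvu cvu e3.
have [d2 d20 D2] := second_difference dv duv cuv e3.
pose d := Num.min d1 d2.
have d0 : 0 < d by rewrite lt_min d10 d20.
pose h := d / 2.
have h0 : 0 < h by rewrite divr_gt0.
have hd : h < d by rewrite /h ltr_pdivrMr// ltr_pMr// ltr1n.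
have [h1 h2] : h < d1 /\ h < d2 by move: hd; rewrite lt_min => /andP.
have := D1 h; rewrite h0 h1 => /(_ isT).
have := D2 h; rewrite h0 h2 => /(_ isT).
rewrite [x + h *: v + h *: u]addrAC.
set a := f (_ + _ + _); set b := f (_ + _); set c := f (_ + _).
set p := 'D_v _ _; set q := 'D_u _ _ => E2 E1.
have hh : 0 < h ^+ 2 by rewrite exprn_gt0.
rewrite add0r -(ler_pM2r hh) -[X in _ * X <= _](gtr0_norm hh) -normrM.
have -> : (p - q) * h ^+ 2 = (a - b - c + f x - h ^+ 2 * q) - (a - c - b + f x - h ^+ 2 * p) by ring.
by rewrite (le_trans (ler_normB _ _))// (le_trans (lerD E2 E1))// -mulrDl -splitr.
Qed.

End DirectionalDerivatives.

Lemma addmxE (R : nmodType) p q (A B : 'M[R]_(p, q)) i j : (A + B) i j = A i j + B i j.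
Proof. by rewrite mxE. Qed.

Lemma oppmxE (R : zmodType) p q (A : 'M[R]_(p, q)) i j : (- A) i j = - A i j.
Proof. by rewrite mxE. Qed.

Lemma scalemxE (R : pzRingType) p q k (A : 'M[R]_(p, q)) i j : (k *: A) i j = k * A i j.
Proof. by rewrite mxE. Qed.

(** * Derivatives of matrix-valued functions *)

Section MatrixDerivatives.
Variables (R : realType) (V : normedModType R).
Implicit Types (x v : V).

Lemma is_derive_mxP p q (f : V -> 'M[R]_(p, q)) x v (df : 'M[R]_(p, q)) :
  is_derive x v f df <-> forall i j, is_derive x v (fun y => f y i j) (df i j).
Proof.
split=> [[d <-] i j|H].
  split; first by move/derivable_mxP: d; exact.
  by rewrite (derive_mx d) mxE.
have d : derivable f x v by apply/derivable_mxP => i j; case: (H i j).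
split=> //; apply/matrixP => i j; rewrite (derive_mx d) mxE.
by case: (H i j).
Qed.

Lemma is_derive_bigsum n (h : 'I_n -> V -> R) x v (dh : 'I_n -> R) :
  (forall i, is_derive x v (h i) (dh i)) ->
  is_derive x v (fun y => \sum_i h i y) (\sum_i dh i).
Proof.
move=> H; rewrite (_ : (fun y => _) = \sum_i h i); first exact: is_derive_sum.
by apply/funext => y; rewrite fct_sumE.
Qed.

Lemma is_derive_mulmx p q r (f : V -> 'M[R]_(p, q)) (g : V -> 'M[R]_(q, r)) x v df dg :
  is_derive x v f df -> is_derive x v g dg ->
  is_derive x v (fun y => f y *m g y) (df *m g x + f x *m dg).
Proof.
move=> /is_derive_mxP Hf /is_derive_mxP Hg; apply/is_derive_mxP => i j.
rewrite (_ : (fun y => _) = (fun y => \sum_k f y i k * g y k j)); last first.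
  by apply/funext => y; rewrite mxE.
rewrite !mxE -big_split/=; apply: is_derive_bigsum => k.
have fk := Hf i k; have gk := Hg k j.
apply: is_derive_eq.
by rewrite addrC [g x k j *: _]mulrC.
Qed.

Lemma is_derive_trmx p q (f : V -> 'M[R]_(p, q)) x v df :
  is_derive x v f df -> is_derive x v (fun y => (f y)^T) df^T.
Proof.
move=> /is_derive_mxP H; apply/is_derive_mxP => i j; rewrite mxE.
by rewrite (_ : (fun y => _) = (fun y => f y j i))//; apply/funext => y; rewrite mxE.
Qed.

Lemma is_derive_mxtrace p (f : V -> 'M[R]_p) x v df :
  is_derive x v f df -> is_derive x v (fun y => \tr (f y)) (\tr df).
Proof. by move=> /is_derive_mxP H; apply: is_derive_bigsum => i. Qed.

Lemma derivable_bigprod (I : Type) (r : seq I) (F : I -> V -> R) x v :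
  (forall i, derivable (F i) x v) -> derivable (fun y => \prod_(i <- r) F i y) x v.
Proof.
move=> H; elim: r => [|i r IH].
  by under eq_fun do rewrite big_nil; exact: derivable_cst.
under eq_fun do rewrite big_cons.
exact: (derivableM (f := F i) (g := fun y => \prod_(i <- r) F i y)).
Qed.

Lemma derivable_bigsum (I : Type) (r : seq I) (F : I -> V -> R) x v :
  (forall i, derivable (F i) x v) -> derivable (fun y => \sum_(i <- r) F i y) x v.
Proof.
move=> H; elim: r => [|i r IH].
  by under eq_fun do rewrite big_nil; exact: derivable_cst.
under eq_fun do rewrite big_cons.
exact: (derivableD (f := F i) (g := fun y => \sum_(i <- r) F i y)).
Qed.

Lemma derivable_det p (f : V -> 'M[R]_p) x v :
  derivable f x v -> derivable (fun y => \det (f y)) x v.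
Proof.
move=> /derivable_mxP H; apply: derivable_bigsum => s.
apply: derivableM; first exact: derivable_cst.
exact: derivable_bigprod.
Qed.

(** By Cramer's rule the inverse is, near [x], the adjugate divided by the determinant, both
    polynomial in the entries of [f]. *)
Lemma derivable_invmx p (f : V -> 'M[R]_p) x v :
  (\forall y \near x, f y \in unitmx) -> derivable f x v ->
  derivable (fun y => invmx (f y)) x v.
Proof.
move=> fU df.
have E : {near x, (fun y => (\det (f y))^-1 *: \adj (f y)) =1 (fun y => invmx (f y))}.
  by near=> y; rewrite /invmx (near fU y).
apply: (near_eq_derivable E).
apply/derivable_mxP => i j.
under eq_fun do rewrite !mxE.
apply: derivableM.
  apply: derivableV; last exact: derivable_det.
  by have := nbhs_singleton fU; rewrite unitmxE unitfE.
rewrite /cofactor; apply: derivableM; first exact: derivable_cst.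
apply: derivable_det; apply/derivable_mxP => k l.
under eq_fun do rewrite !mxE.
by move/derivable_mxP: df; exact.
Unshelve. all: by end_near. Qed.

Lemma derive_open_eq p q (f h : V -> 'M[R]_(p, q)) (U : set V) x v :
  open U -> U x -> (forall y, U y -> f y = h y) -> 'D_v f x = 'D_v h x.
Proof.
move=> oU Ux E; apply: near_eq_derive.
by near=> y; apply: E; near: y; exact: open_nbhs_nbhs.
Unshelve. all: by end_near. Qed.

End MatrixDerivatives.

(** * Smooth matrix-valued functions on an open set *)

Section SmoothMatrices.
Variables (R : realType) (V : normedModType R) (U : set V).
Hypothesis oU : open U.

Lemma Ck_ext (W : normedModType R) k (f h : V -> W) :
  (forall y, U y -> f y = h y) -> Ck k U f -> Ck k U h.
Proof.
have near_U x : U x -> \forall y \near x, U y by move=> Ux; exact: open_nbhs_nbhs.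
elim: k f h => [|k IH] f h E /= [cf df]; split.
- move=> x Ux; have c : f @ x --> f x := cf x Ux.
  change (h @ x --> h x); rewrite -(E x Ux); apply: cvg_trans c.
  apply: near_eq_cvg; near=> y; apply: E; near: y; exact: near_U.
- by [].
- move=> x Ux; have c : f @ x --> f x := cf x Ux.
  change (h @ x --> h x); rewrite -(E x Ux); apply: cvg_trans c.
  apply: near_eq_cvg; near=> y; apply: E; near: y; exact: near_U.
- have E' x : U x -> {near x, f =1 h}.
    by move=> Ux; near=> y; apply: E; near: y; exact: near_U.
  move=> v; have [d C] := df v; split.
    by move=> x Ux; apply: near_eq_derivable (d x Ux); exact: E'.
  apply: IH C => y Uy; apply: near_eq_derive; exact: E'.
Unshelve. all: by end_near. Qed.

Lemma smooth_derivable (W : normedModType R) (f : V -> W) x v :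
  smooth_on U f -> U x -> derivable f x v.
Proof. by move=> /(_ 1%N)/= [_ /(_ v)[d _]]; exact: d. Qed.

Lemma smooth_derive (W : normedModType R) (f : V -> W) v :
  smooth_on U f -> smooth_on U ('D_v f).
Proof. by move=> sf k; have /= [_ /(_ v)[_]] := sf k.+1. Qed.

Lemma smooth_continuous (W : normedModType R) (f : V -> W) x :
  smooth_on U f -> U x -> {for x, continuous f}.
Proof. by move=> /(_ 0%N)/= [c _]; exact: c. Qed.

Lemma smooth_cst (W : normedModType R) (c : W) : smooth_on U (cst c).
Proof.
suff H k : forall c : W, Ck k U (cst c : V -> W) by move=> k; exact: H.
elim: k => [|k IH] {}c /=; split.
- by move=> x _; exact: cst_continuous.
- by [].
- by move=> x _; exact: cst_continuous.
- move=> v; split; first by move=> x _; exact: derivable_cst.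
  by under eq_fun do rewrite derive_cst; exact: IH.
Qed.

Variables (p q : nat).
Implicit Types (f : V -> 'M[R]_(p, q)) (x u v : V).

Lemma smooth_entry f i j : smooth_on U f -> smooth_on U (fun y => f y i j).
Proof.
suff H k : forall f, Ck k U f -> Ck k U (fun y => f y i j).
  by move=> sf k; exact/H/sf.
elim: k => [|k IH] {}f /= [cf df]; split.
- by move=> x Ux; apply: (@continuous_comp _ _ _ f (fun A => A i j)); [exact: cf|exact: coord_continuous].
- by [].
- by move=> x Ux; apply: (@continuous_comp _ _ _ f (fun A => A i j)); [exact: cf|exact: coord_continuous].
- move=> v; have [d C] := df v; split.
    by move=> x Ux; move/derivable_mxP: (d x Ux); exact.
  by apply: Ck_ext (IH _ C) => y Uy; rewrite (derive_mx (d y Uy)) mxE.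
Qed.

Lemma smooth_is_derive f x v : smooth_on U f -> U x -> is_derive x v f ('D_v f x).
Proof. by move=> sf Ux; apply: derivableP; exact: smooth_derivable. Qed.

Lemma derive_entry f x v (i : 'I_p) (j : 'I_q) : smooth_on U f -> U x ->
  ('D_v f x) i j = 'D_v (fun y => f y i j) x.
Proof. by move=> sf Ux; rewrite (derive_mx (smooth_derivable sf Ux)) mxE. Qed.

Lemma near_open (P : V -> Prop) x : U x -> (forall y, U y -> P y) -> \forall y \near x, P y.
Proof.
move=> Ux H; near=> y; apply: H; near: y; exact: open_nbhs_nbhs.
Unshelve. all: by end_near. Qed.

(** Additivity in the direction is not built into directional derivatives; smoothness gives each
    entry the continuity that [deriveDv] asks for. *)
Lemma smooth_deriveDv f x u v : smooth_on U f -> U x ->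
  'D_(u + v) f x = 'D_u f x + 'D_v f x.
Proof.
move=> sf Ux; apply/matrixP => i j.
have sfe := smooth_entry i j sf.
have D w : derivable (fun y => f y i j) x w := smooth_derivable sfe Ux.
have N : \forall y \near x, derivable (fun y => f y i j) y u.
  by apply: near_open => // y Uy; exact: (smooth_derivable sfe).
have C := smooth_continuous (smooth_derive u sfe) Ux.
apply: (eq_trans (derive_entry (u + v) i j sf Ux)).
apply: (eq_trans (deriveDv N C (D v) (D (u + v)))).
apply: esym; apply: (eq_trans (addmxE _ _ _ _)).
exact: (f_equal2 +%R (derive_entry u i j sf Ux) (derive_entry v i j sf Ux)).
Qed.

Lemma smooth_deriveZv f x k v : smooth_on U f -> U x ->
  'D_(k *: v) f x = k *: 'D_v f x.
Proof.
move=> sf Ux; apply/matrixP => i j.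
have D w : derivable (fun y => f y i j) x w := smooth_derivable (smooth_entry i j sf) Ux.
apply: (eq_trans (derive_entry (k *: v) i j sf Ux)).
apply: (eq_trans (deriveZv (D v) (D (k *: v)))).
apply: esym; apply: (eq_trans (scalemxE _ _ _ _)).
exact: (f_equal ( *%R k) (derive_entry v i j sf Ux)).
Qed.

Lemma smooth_derive_commute f x u v : smooth_on U f -> U x ->
  'D_v ('D_u f) x = 'D_u ('D_v f) x.
Proof.
move=> sf Ux; apply/matrixP => i j.
have sfe := smooth_entry i j sf.
have E w w' : 'D_w' (fun y => ('D_w f y) i j) x = 'D_w' ('D_w (fun y => f y i j)) x.
  apply: near_eq_derive; apply: near_open => // y Uy; exact: derive_entry.
have D w w' := eq_trans (derive_entry w' i j (smooth_derive w sf) Ux) (E w w').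
have N w : \forall y \near x, derivable (fun y => f y i j) y w.
  by apply: near_open => // y Uy; exact: (smooth_derivable sfe).
have N2 w w' : \forall y \near x, derivable ('D_w (fun y => f y i j)) y w'.
  by apply: near_open => // y Uy; exact: (smooth_derivable (smooth_derive w sfe)).
have C w w' := smooth_continuous (smooth_derive w' (smooth_derive w sfe)) Ux.
apply: (eq_trans (D u v)); apply: esym; apply: (eq_trans (D v u)).
exact: (derive_commute (N v) (N u) (N2 v u) (N2 u v) (C v u) (C u v)).
Qed.

End SmoothMatrices.

(** * The Levi-Civita connection in a chart *)

Section Bilinear.
Variables (R : realType) (m : nat).
Notation V := 'rV[R]_m.+1.
Implicit Types (B C : 'M[R]_m.+1) (a b c : V) (k : R).

Lemma app2Dm B C a b : app2 (B + C) a b = app2 B a b + app2 C a b.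
Proof. by rewrite /app2 mulmxDr mulmxDl mxE. Qed.

Lemma app2Dl B a b c : app2 B (a + b) c = app2 B a c + app2 B b c.
Proof. by rewrite /app2 !mulmxDl mxE. Qed.

Lemma app2Dr B a b c : app2 B a (b + c) = app2 B a b + app2 B a c.
Proof. by rewrite /app2 linearD mulmxDr mxE. Qed.

Lemma app2Zm B a b k : app2 (k *: B) a b = k * app2 B a b.
Proof. by rewrite /app2 -scalemxAr -scalemxAl mxE. Qed.

Lemma app2Zl B a b k : app2 B (k *: a) b = k * app2 B a b.
Proof. by rewrite /app2 -!scalemxAl mxE. Qed.

Lemma app2Zr B a b k : app2 B a (k *: b) = k * app2 B a b.
Proof. by rewrite /app2 linearZ -scalemxAr mxE. Qed.

Lemma app2Nl B a b : app2 B (- a) b = - app2 B a b.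
Proof. by rewrite -scaleN1r app2Zl mulN1r. Qed.

Lemma app2Nr B a b : app2 B a (- b) = - app2 B a b.
Proof. by rewrite -scaleN1r app2Zr mulN1r. Qed.

Lemma app2Nm B a b : app2 (- B) a b = - app2 B a b.
Proof. by rewrite -scaleN1r app2Zm mulN1r. Qed.

Lemma mul_app2 B a b c : a *m B *m b^T *m c = app2 B a b *: c.
Proof. by rewrite [a *m B *m b^T]mx11_scalar mul_scalar_mx. Qed.

Lemma mul_rank1 (e : 'cV[R]_m.+1) a c : a *m (e *m c) = app1 e a *: c.
Proof. by rewrite mulmxA [a *m e]mx11_scalar mul_scalar_mx. Qed.

Lemma app20l B a : app2 B 0 a = 0.
Proof. by rewrite /app2 !mul0mx mxE. Qed.

Lemma app20r B a : app2 B a 0 = 0.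
Proof. by rewrite /app2 trmx0 mulmx0 mxE. Qed.

Lemma app2_mull B C a b : app2 (C *m B) a b = app2 B (a *m C) b.
Proof. by rewrite /app2 !mulmxA. Qed.

Lemma app2_mulr B C a b : app2 (B *m C^T) a b = app2 B a (b *m C).
Proof. by rewrite /app2 trmx_mul !mulmxA. Qed.

Lemma app2_tr B a b : app2 B^T a b = app2 B b a.
Proof.
by rewrite /app2 -[a *m _ *m _]trmxK [LHS]mxE !trmx_mul !trmxK mulmxA.
Qed.

Lemma app2_delta B i j : app2 B (delta_mx 0 i) (delta_mx 0 j) = B i j.
Proof. by rewrite /app2 trmx_delta -rowE -colE !mxE. Qed.

Lemma app2_inj B C : (forall a b, app2 B a b = app2 C a b) -> B = C.
Proof. by move=> H; apply/matrixP => i j; rewrite -!app2_delta. Qed.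

Lemma mul_rows_delta (f : V -> V) v :
  (forall a b, f (a + b) = f a + f b) -> (forall k a, f (k *: a) = k *: f a) ->
  v *m (\matrix_i f (delta_mx 0 i)) = f v.
Proof.
move=> fD fZ; rewrite mulmx_sum_row {2}(row_sum_delta v). 
have f0 : f 0 = 0 by have := fZ 0 0; rewrite !scale0r.
by rewrite (big_morph f fD f0); apply: eq_bigr => i _; rewrite rowK fZ.
Qed.

Lemma mul_row_delta (K : V) (z : V) (f : V -> R) :
  (forall a b, f (a + b) = f a + f b) -> (forall k a, f (k *: a) = k * f a) ->
  (forall i, K 0 i = f (delta_mx 0 i)) -> (K *m z^T) 0 0 = f z.
Proof.
move=> fD fZ KE; rewrite {2}(row_sum_delta z) mxE.
have f0 : f 0 = 0 by have := fZ 0 0; rewrite scale0r mul0r.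
by rewrite (big_morph f fD f0); apply: eq_bigr => i _; rewrite fZ mxE KE mulrC.
Qed.

Lemma app2_bilinear_mx (f : V -> V -> R) v z :
  (forall a b c, f (a + b) c = f a c + f b c) ->
  (forall k a c, f (k *: a) c = k * f a c) ->
  (forall a b c, f a (b + c) = f a b + f a c) ->
  (forall k a c, f a (k *: c) = k * f a c) ->
  app2 (\matrix_(i, j) f (delta_mx 0 i) (delta_mx 0 j)) v z = f v z.
Proof.
move=> fDl fZl fDr fZr; rewrite /app2.
have -> : \matrix_(i, j) f (delta_mx 0 i) (delta_mx 0 j) =
    \matrix_i \row_j f (delta_mx 0 i) (delta_mx 0 j).
  by apply/matrixP => i j; rewrite !mxE.
rewrite (mul_rows_delta (f := fun v => \row_j f v (delta_mx 0 j))).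
- by apply: mul_row_delta => // j; rewrite mxE.
- by move=> a b; apply/rowP => j; rewrite !mxE fDl.
- by move=> k a; apply/rowP => j; rewrite !mxE fZl.
Qed.

End Bilinear.

(** * Christoffel symbols at one point, as linear algebra *)

Section ChristoffelAlgebra.
Variables (R : realType) (m : nat).
Notation V := 'rV[R]_m.+1.
Variables (G : 'M[R]_m.+1) (B : V -> 'M[R]_m.+1).
Implicit Types (u v w z : V).

(** The Christoffel symbols of the first kind: with [G] the metric at a point and [B u] its
    derivative along [u], this is the Koszul formula for constant fields. *)
Definition lowered_christoffel u v z : R :=
  2^-1 * (app2 (B u) v z + app2 (B v) u z - app2 (B z) u v).

Definition lowered_christoffel_mx u : 'M[R]_m.+1 :=
  \matrix_(i, j) lowered_christoffel u (delta_mx 0 i) (delta_mx 0 j).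

(** The factor [invmx G] raises the index; [v *m christoffel_mx u] is the zero-order term of the
    covariant derivative of [v] along [u]. *)
Definition christoffel_mx u : 'M[R]_m.+1 := lowered_christoffel_mx u *m invmx G.

Hypothesis BD : forall u v, B (u + v) = B u + B v.
Hypothesis BZ : forall k u, B (k *: u) = k *: B u.

Lemma lowered_christoffel_mxE u v z :
  app2 (lowered_christoffel_mx u) v z = lowered_christoffel u v z.
Proof.
apply: app2_bilinear_mx => [a b c|k a c|a b c|k a c];
  rewrite /lowered_christoffel !(BD, BZ, app2Dl, app2Dr, app2Zl, app2Zr, app2Dm, app2Zm);
  by ring.
Qed.

Lemma mul_christoffel_mx u v :
  v *m christoffel_mx u = \row_j lowered_christoffel u v (delta_mx 0 j) *m invmx G.
Proof.
rewrite mulmxA; congr (_ *m _); apply/rowP => j.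
by rewrite [RHS]mxE -lowered_christoffel_mxE /app2 trmx_delta -colE [RHS]mxE.
Qed.

Hypothesis G_sym : G^T = G.
Hypothesis G_unit : G \in unitmx.
Hypothesis B_sym : forall u, (B u)^T = B u.

Lemma app2_christoffel_mx u v z :
  app2 G (v *m christoffel_mx u) z = lowered_christoffel u v z.
Proof. by rewrite -app2_mull mulmxKV// lowered_christoffel_mxE. Qed.

Lemma app2_symC (C : 'M[R]_m.+1) v z : C^T = C -> app2 C v z = app2 C z v.
Proof. by move=> {2}<-; rewrite app2_tr. Qed.

(** Torsion-freeness: lower the index with the invertible [G]; the Koszul expression is symmetric in
    [u] and [v] because every [B z] is symmetric. *)
Lemma mul_christoffel_mxC u v : v *m christoffel_mx u = u *m christoffel_mx v.
Proof.
rewrite -[LHS](mulmxK G_unit) -[RHS](mulmxK G_unit); congr (_ *m _).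
apply/rowP => j.
have E (a : V) : (a *m G) 0 j = app2 G a (delta_mx 0 j).
  by rewrite /app2 trmx_delta -colE [RHS]mxE.
rewrite !E !app2_christoffel_mx /lowered_christoffel.
by rewrite (app2_symC u v (B_sym _)) [app2 (B u) v _ + _]addrC.
Qed.

(** Metric compatibility: in the sum of two Koszul expressions with the last two arguments
    exchanged, everything but the terms in [B u] cancels. *)
Lemma metric_christoffel_mx u :
  B u = christoffel_mx u *m G + G *m (christoffel_mx u)^T.
Proof.
apply: app2_inj => v z.
rewrite app2Dm app2_mull app2_mulr (app2_symC v _ G_sym) !app2_christoffel_mx.
rewrite /lowered_christoffel (app2_symC z v (B_sym u)).
by rewrite (app2_symC u z (B_sym v)) (app2_symC u v (B_sym z)); field.
Qed.

End ChristoffelAlgebra.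

(** * The connection and curvature matrices in a chart *)

Section Connection.
Variables (R : realType) (m : nat) (U : set 'rV[R]_m.+1).
Notation V := 'rV[R]_m.+1.
Hypothesis oU : open U.
Variable g : V -> 'M[R]_m.+1.
Hypothesis sg : smooth_on U g.
Hypothesis g_sym : forall x, U x -> (g x)^T = g x.
Hypothesis g_unit : forall x, U x -> g x \in unitmx.
Implicit Types (x y u v w z : V).

Definition connection u x : 'M[R]_m.+1 := christoffel_mx (g x) (fun w => 'D_w g x) u.

Lemma derive_metric_sym x u : U x -> ('D_u g x)^T = 'D_u g x.
Proof.
move=> Ux.
have dt := is_derive_trmx (smooth_is_derive u sg Ux).
apply: (eq_trans (esym (@derive_val _ _ _ _ _ _ _ dt))).
exact: (derive_open_eq _ oU Ux g_sym).
Qed.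

Lemma derive_metricD x u v : U x -> 'D_(u + v) g x = 'D_u g x + 'D_v g x.
Proof. exact: (smooth_deriveDv oU u v sg). Qed.

Lemma derive_metricZ x k u : U x -> 'D_(k *: u) g x = k *: 'D_u g x.
Proof. exact: (smooth_deriveZv oU k u sg). Qed.

Lemma mul_connection x u v : U x -> v *m connection u x = christoffel g x u v.
Proof.
move=> Ux; apply: (mul_christoffel_mx (g x) _ _ u v) => [a b|k a].
  exact: derive_metricD.
exact: derive_metricZ.
Qed.

Lemma mul_connectionC x u v : U x -> v *m connection u x = u *m connection v x.
Proof.
move=> Ux; apply: mul_christoffel_mxC => [a b|k a||a].
- exact: derive_metricD.
- exact: derive_metricZ.
- exact: g_unit.
- exact: derive_metric_sym.
Qed.

Lemma derive_metric x u : U x ->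
  'D_u g x = connection u x *m g x + g x *m (connection u x)^T.
Proof.
move=> Ux; apply: (metric_christoffel_mx (B := fun w => 'D_w g x)) => [a b|k a|||a].
- exact: derive_metricD.
- exact: derive_metricZ.
- exact: g_sym.
- exact: g_unit.
- exact: derive_metric_sym.
Qed.

Lemma connection0 x : U x -> connection 0 x = 0.
Proof.
move=> Ux; apply/row_matrixP => i; rewrite row0 rowE mul_connectionC//.
by rewrite mul0mx.
Qed.

Lemma derivable_connection x u w : U x -> derivable (connection u) x w.
Proof.
move=> Ux.
pose K y : 'M[R]_m.+1 := lowered_christoffel_mx (fun w => 'D_w g y) u.
have da v a b : derivable (fun y => app2 ('D_v g y) a b) x w.
  have d := smooth_is_derive w (smooth_derive v sg) Ux.
  have := is_derive_mulmx (is_derive_mulmx (is_derive_cst a x w) d) (is_derive_cst b^T x w).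
  by move=> /is_derive_mxP/(_ 0 0)[].
have dK : derivable K x w.
  apply/derivable_mxP => i j; under eq_fun do rewrite mxE.
  apply: derivableM; first exact: derivable_cst.
  by apply: derivableB => //; apply: derivableD.
have dI : derivable (fun y => invmx (g y)) x w.
  apply: derivable_invmx; last exact: (smooth_derivable sg).
  exact: (near_open oU).
by have [] := is_derive_mulmx (derivableP dK) (derivableP dI).
Qed.

(** The curvature of the connection matrices, arranged so that [v *m curvature_mx w u x] is R(w,u)v.
    The products appear in reverse order because endomorphisms act on the right. *)
Definition curvature_mx w u x : 'M[R]_m.+1 :=
  'D_w (connection u) x - 'D_u (connection w) x
  + connection u x *m connection w x - connection w x *m connection u x.

Lemma derive_mul_connection x u v w : U x ->
  'D_w (fun y => v *m connection u y) x = v *m 'D_w (connection u) x.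
Proof.
move=> Ux.
have d0 : derivable (connection u) x w by exact: derivable_connection.
have d := derivableP d0.
have := is_derive_mulmx (is_derive_cst v x w) d.
by move=> /(@derive_val _ _ _ _ _ _ _) ->; rewrite mul0mx add0r.
Qed.

Lemma levi_civita_cst x u v : U x -> levi_civita g (cst u) (cst v) x = v *m connection u x.
Proof. by move=> Ux; rewrite /levi_civita /der derive_cst add0r mul_connection. Qed.

Lemma curvatureE x w u v : U x ->
  curvature g (cst w) (cst u) (cst v) x = v *m curvature_mx w u x.
Proof.
move=> Ux.
have L a b : levi_civita g (cst a) (levi_civita g (cst b) (cst v)) x =
    v *m 'D_a (connection b) x + v *m connection b x *m connection a x.
  have E : 'D_a (levi_civita g (cst b) (cst v)) x = v *m 'D_a (connection b) x.
    apply: eq_trans (derive_mul_connection b v a Ux).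
    by apply: (derive_open_eq _ oU Ux) => y Uy; exact: levi_civita_cst.
  apply: (f_equal2 +%R E).
  by rewrite -mul_connection// levi_civita_cst.
rewrite /curvature !L.
have -> : lie (cst w) (cst u) = cst (0 : V).
  by apply/funext => y; rewrite /lie /der !derive_cst subrr.
rewrite levi_civita_cst// connection0// mulmx0 subr0 /curvature_mx.
by rewrite !mulmxDr !mulmxN !mulmxA opprD addrACA addrA.
Qed.

Lemma ricciE x u v : U x ->
  ricci g x u v = \sum_i (v *m curvature_mx (delta_mx 0 i) u x) 0 i.
Proof.
move=> Ux; rewrite /ricci; apply: eq_bigr => i _.
by rewrite mxE/= curvatureE.
Qed.

End Connection.

Lemma mx0E (R : nmodType) p q i j : (0 : 'M[R]_(p, q)) i j = 0.
Proof. by rewrite mxE. Qed.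

(** Matrix products do not commute, so identities are expanded into monomials and then compared
    entrywise; [ring] and [lra] see the entry of each monomial as an atom. *)
Ltac mx_expand :=
  rewrite ?(mulmxDl, mulmxDr, mulmxN, mulNmx, mulmxA, opprD, opprK, mulmx1, mul1mx).
Ltac mx_entries i j := apply/matrixP => i j; rewrite ?(addmxE, oppmxE, mx0E).

Lemma trmxDE (R : nmodType) p q (A B : 'M[R]_(p, q)) : (A + B)^T = A^T + B^T.
Proof. by apply/matrixP => i j; rewrite !mxE. Qed.

Lemma trmxNE (R : zmodType) p q (A : 'M[R]_(p, q)) : (- A)^T = - A^T.
Proof. by apply/matrixP => i j; rewrite !mxE. Qed.

(** * Algebraic form of the commutation of second derivatives *)

Section CurvatureAlgebra.
Variables (R : realFieldType) (N : nat).
Implicit Types (a b p q X : 'M[R]_N).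

(** Here [a], [b] stand for the connection matrices in directions [u], [w], and [p], [q] for the
    derivatives of [a] along [w] and of [b] along [u]. The hypothesis equates the mixed second
    derivatives of a parallel endomorphism [X]; terms such as [a *m X *m b] cancel. The next two
    lemmas do the same for the metric and for a parallel vector field. *)
Lemma commute_curvature a b p q X :
  p *m X + a *m (b *m X - X *m b) - ((b *m X - X *m b) *m a + X *m p)
  = q *m X + b *m (a *m X - X *m a) - ((a *m X - X *m a) *m b + X *m q) ->
  (p - q + a *m b - b *m a) *m X = X *m (p - q + a *m b - b *m a).
Proof.
mx_expand => H; mx_entries i j.
by have := congr1 (fun M : 'M[R]_N => M i j) H; rewrite ?(addmxE, oppmxE, mx0E); lra.
Qed.

Lemma skew_curvature a b p q X :
  p *m X + a *m (b *m X + X *m b^T) + ((b *m X + X *m b^T) *m a^T + X *m p^T)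
  = q *m X + b *m (a *m X + X *m a^T) + ((a *m X + X *m a^T) *m b^T + X *m q^T) ->
  (p - q + a *m b - b *m a) *m X = - (X *m (p - q + a *m b - b *m a)^T).
Proof.
rewrite !(trmxDE, trmxNE) !trmx_mul; mx_expand => H; mx_entries i j.
by have := congr1 (fun M : 'M[R]_N => M i j) H; rewrite ?(addmxE, oppmxE, mx0E); lra.
Qed.

Lemma kill_curvature n a b p q (xi : 'M[R]_(n, N)) :
  - (- (xi *m b) *m a + xi *m p) = - (- (xi *m a) *m b + xi *m q) ->
  xi *m (p - q + a *m b - b *m a) = 0.
Proof.
mx_expand => H; mx_entries i j.
by have := congr1 (fun M : 'M[R]_(n, N) => M i j) H; rewrite ?(addmxE, oppmxE, mx0E); lra.
Qed.

(** The hypothesis says that [S] is conjugate to [- S^T], and the trace is invariant under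
    conjugation and transposition. *)
Lemma mxtrace_skew (G S : 'M[R]_N) : G \in unitmx -> S *m G = - (G *m S^T) -> \tr S = 0.
Proof.
move=> Gu H.
have : \tr S = - \tr S.
  rewrite -{1}(mulmxK Gu S) H mulNmx raddfN/= -mulmxA mxtrace_mulC -mulmxA mulVmx//.
  by rewrite mulmx1 mxtrace_tr.
lra.
Qed.

End CurvatureAlgebra.

(** * Symmetries of the curvature *)

Section Curvature.
Variables (R : realType) (m : nat) (U : set 'rV[R]_m.+1).
Notation V := 'rV[R]_m.+1.
Hypothesis oU : open U.
Variable g : V -> 'M[R]_m.+1.
Hypothesis sg : smooth_on U g.
Hypothesis g_sym : forall x, U x -> (g x)^T = g x.
Hypothesis g_unit : forall x, U x -> g x \in unitmx.
Implicit Types (x y u v w z : V).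

Local Notation om := (connection g).
Local Notation Rm := (curvature_mx g).

Lemma is_derive_connection x u w : U x -> is_derive x w (om u) ('D_w (om u) x).
Proof. by move=> Ux; apply: derivableP; exact: (derivable_connection oU sg g_unit). Qed.

Lemma curvature_mxC x u w : Rm w u x = - Rm u w x.
Proof.
have H (p q a b : 'M[R]_m.+1) : p - q + a - b = - (q - p + b - a).
  by mx_entries i j; ring.
exact: H.
Qed.

(** The equation ['D_u f = h u] holds on all of [U], so it can be differentiated; symmetry of the
    mixed derivatives of [f] becomes an integrability condition on [h]. *)
Lemma second_derive p q (f : V -> 'M[R]_(p, q)) (h : V -> V -> 'M[R]_(p, q)) dh x u w :
  smooth_on U f -> U x -> (forall u y, U y -> 'D_u f y = h u y) ->
  (forall u w, is_derive x w (h u) (dh u w)) ->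
  dh u w = dh w u.
Proof.
move=> sf Ux E H.
have F u' w' : dh u' w' = 'D_w' ('D_u' f) x.
  apply: (eq_trans (esym (@derive_val _ _ _ _ _ _ _ (H u' w')))).
  by apply: (derive_open_eq _ oU Ux) => y Uy; apply/esym/E.
apply: (eq_trans (F u w)); apply: esym; apply: (eq_trans (F w u)).
exact: (smooth_derive_commute oU w u sf Ux).
Qed.

Lemma curvature_commute (X : V -> 'M[R]_m.+1) x u w : smooth_on U X ->
  (forall u y, U y -> 'D_u X y = om u y *m X y - X y *m om u y) -> U x ->
  Rm w u x *m X x = X x *m Rm w u x.
Proof.
move=> sX E Ux; rewrite /curvature_mx; apply: commute_curvature.
have dX v : is_derive x v X (om v x *m X x - X x *m om v x).
  by rewrite -E//; exact: smooth_is_derive.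
apply: (second_derive (h := fun u y => om u y *m X y - X y *m om u y)
  (dh := fun u w => 'D_w (om u) x *m X x + om u x *m (om w x *m X x - X x *m om w x)
   - ((om w x *m X x - X x *m om w x) *m om u x + X x *m 'D_w (om u) x)) u w sX Ux E _) => u' w'.
have dom := is_derive_connection u' w' Ux.
exact: (is_deriveB (is_derive_mulmx dom (dX w')) (is_derive_mulmx (dX w') dom)).
Qed.

Lemma curvature_skew x u w : U x -> Rm w u x *m g x = - (g x *m (Rm w u x)^T).
Proof.
move=> Ux; rewrite /curvature_mx; apply: skew_curvature.
have E u' y : U y -> 'D_u' g y = om u' y *m g y + g y *m (om u' y)^T.
  by move=> Uy; exact: (derive_metric oU sg g_sym g_unit).
have dg v : is_derive x v g (om v x *m g x + g x *m (om v x)^T).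
  by rewrite -E//; exact: smooth_is_derive.
apply: (second_derive (h := fun u y => om u y *m g y + g y *m (om u y)^T)
  (dh := fun u w => 'D_w (om u) x *m g x + om u x *m (om w x *m g x + g x *m (om w x)^T)
   + ((om w x *m g x + g x *m (om w x)^T) *m (om u x)^T + g x *m ('D_w (om u) x)^T)) u w sg Ux E _) => u' w'.
have dom := is_derive_connection u' w' Ux.
exact: (is_deriveD (is_derive_mulmx dom (dg w')) (is_derive_mulmx (dg w') (is_derive_trmx dom))).
Qed.

Lemma curvature_kill (X : V -> V) x u w : smooth_on U X ->
  (forall u y, U y -> 'D_u X y = - (X y *m om u y)) -> U x ->
  X x *m Rm w u x = 0.
Proof.
move=> sX E Ux; rewrite /curvature_mx; apply: kill_curvature.
have dX v : is_derive x v X (- (X x *m om v x)).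
  by rewrite -E//; exact: smooth_is_derive.
apply: (second_derive (h := fun u y => - (X y *m om u y))
  (dh := fun u w => - (- (X x *m om w x) *m om u x + X x *m 'D_w (om u) x)) u w sX Ux E _) => u' w'.
exact: (is_deriveN (is_derive_mulmx (dX w') (is_derive_connection u' w' Ux))).
Qed.

(** Torsion-freeness holds throughout [U] and can be differentiated, so [b *m 'D_c (om a) x] is
    symmetric in [a] and [b]. In the cyclic sum this cancels the derivative terms in pairs, and
    torsion-freeness at [x] cancels the products. *)
Lemma curvature_bianchi x u v w : U x ->
  v *m Rm w u x + w *m Rm u v x + u *m Rm v w x = 0.
Proof.
move=> Ux; rewrite /curvature_mx.
have S a b := mul_connectionC oU sg g_sym g_unit a b Ux.
have D a b c : b *m 'D_c (om a) x = a *m 'D_c (om b) x.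
  apply: (eq_trans (esym (derive_mul_connection oU sg g_unit a b c Ux))).
  apply: (eq_trans _ (derive_mul_connection oU sg g_unit b a c Ux)).
  by apply: (derive_open_eq _ oU Ux) => y Uy; exact: (mul_connectionC oU sg g_sym g_unit).
have := D u v w; have := D w v u; have := D u w v.
have := S u v; have := S w v; have := S u w.
move: ('D_w (om u) x) ('D_u (om w) x) ('D_u (om v) x) ('D_v (om u) x) ('D_v (om w) x) ('D_w (om v) x).
move: (om u x) (om v x) (om w x) => a b c p1 p2 p3 p4 p5 p6 S1 S2 S3 E1 E2 E3.
mx_expand; rewrite S3 E3 -S2 E2 S1 E1; by mx_entries i j; lra.
Qed.

Lemma curvature_trace0 x u w : U x -> \tr (Rm w u x) = 0.
Proof. by move=> Ux; apply: mxtrace_skew (g_unit Ux) (curvature_skew u w Ux). Qed.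

End Curvature.

(** * Almost contact metric structures *)

Section ContactIdentities.
Variables (R : realFieldType) (V : Type) (phi : V -> V) (xi : V) (eta : V -> R)
  (t : V -> V -> V -> R) (s : V -> V -> R).
Hypothesis eta_xi : eta xi = 1.
Hypothesis s_phi2r : forall u v, s u (phi (phi v)) = - s u v + eta v * s u xi.
Hypothesis t_phi2r : forall u v z, t u v (phi (phi z)) = - t u v z + eta z * t u v xi.
Hypothesis t_phixi0 : forall u v, t (phi xi) u v = 0.
Hypothesis t_phixi0r : forall u v, t u v (phi xi) = 0.
Hypothesis s_xir : forall u, s u xi = 0.
Hypothesis t_skew : forall u v z, t u v z = - t u z v.
Hypothesis t_phim : forall u v z, t u (phi v) z = t u v (phi z) + s u v * eta z + eta v * s u z.
Hypothesis t_xim : forall u v, t u xi v = s u (phi v).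
Hypothesis normal : forall u v z,
  t (phi u) v z - t (phi v) u z + t u v (phi z) - t v u (phi z) + (s u v - s v u) * eta z = 0.
Hypothesis closed : forall u v z, t u v z + t v z u + t z u v = 0.


Lemma s_xil u : s xi u = 0.
Proof.
have := normal u xi xi; have := t_skew (phi u) xi xi.
by rewrite t_phixi0 !t_phixi0r eta_xi s_xir; lra.
Qed.

Lemma t_xir u v : t u v xi = - s u (phi v).
Proof. by rewrite t_skew t_xim. Qed.

(** Let Q(u,v,z) be the left side plus [s u v * eta z]. Normality makes Q symmetric in its first two
    arguments, while [t_skew] and [t_phim] make it skew in the last two (this is [P]). Such a Q
    vanishes, as in the uniqueness proof for the Levi-Civita connection. *)
Lemma t_phi_exchange u v z : t (phi u) v z + t u v (phi z) = - (s u v * eta z).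
Proof.
have P a b c : (t (phi a) b c + t a b (phi c)) + (t (phi a) c b + t a c (phi b))
    = - (s a b * eta c + eta b * s a c).
  have := t_skew (phi a) b c; have := t_skew a c (phi b); have := t_phim a b c; lra.
have := P u v z; have := P z u v; have := P v z u.
have := normal u z v; have := normal z v u; have := normal v u z.
rewrite ![eta _ * s _ _]mulrC !mulrBl; lra.
Qed.

Lemma s_phi u v : s (phi u) (phi v) = s u v.
Proof. by have := t_phi_exchange u v xi; rewrite t_phixi0r t_xir eta_xi; lra. Qed.

(** The exchange relation at [xi] shows that [t xi] vanishes, so closedness at [xi] makes
    [s z (phi w)] symmetric in [z] and [w]. Substituting [phi v] for [w] and using the invariance
    [s_phi] gives the claim. *)
Lemma s_skew u v : s u v = - s v u.
Proof.
have t0 z w : t xi z (phi w) = 0.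
  by have := t_phi_exchange xi z w; rewrite t_phixi0 s_xil; lra.
have t0' z w : t xi z w = 0.
  have := t_phi2r xi z w; rewrite t0 t_xir s_xil; lra.
have E z w : s z (phi w) = s w (phi z).
  have := closed xi z w; rewrite t0' t_xir t_xim; lra.
have := E u (phi v); rewrite s_phi2r s_xir s_phi; lra.
Qed.

(** Once [s] vanishes, [phi] moves freely between the arguments of [t], with a sign when it enters
    or leaves the first. Two instances of closedness then have opposite signs in two of their three
    terms, and adding them isolates [t a b (phi c)]. *)
Lemma t_eq0 u v z : (forall u v, s u v = 0) -> t u v z = 0.
Proof.
move=> s0.
have E a b c : t (phi a) b c = - t a b (phi c).
  by have := t_phi_exchange a b c; rewrite s0; lra.
have F a b c : t a (phi b) c = t a b (phi c).
  by have := t_phim a b c; rewrite !s0; lra.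
have G a b c : t a b (phi c) = 0.
  have := closed (phi c) a b; have := closed c a (phi b).
  by rewrite !E !F; lra.
have := t_phi2r u v z; rewrite G t_xir s0; lra.
Qed.

(** Symmetry of [s] is the form in which d eta = 0 enters; with the skew symmetry it gives
    [s = 0]. *)
Lemma contact_identities :
  [/\ forall u, s xi u = 0, forall u v, s u v = - s v u
    & (forall u v, s u v = s v u) ->
      (forall u v, s u v = 0) /\ forall u v z, t u v z = 0].
Proof.
split=> [u|u v|sC]; [exact: s_xil|exact: s_skew|].
have s0 u v : s u v = 0 by have := s_skew u v; have := sC u v; lra.
by split=> // u v z; exact: t_eq0.
Qed.

End ContactIdentities.

(** * Algebra of an almost contact metric structure at one point *)

Section AlmostContactAlgebra.
Variables (R : realType) (m : nat).
Notation V := 'rV[R]_m.+1.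
Variables (G P : 'M[R]_m.+1) (X : V) (E : 'cV[R]_m.+1).
Hypothesis G_sym : G^T = G.
Hypothesis PP : forall u, u *m P *m P = - u + app1 E u *: X.
Hypothesis EX : app1 E X = 1.
Hypothesis GP : forall u v, app2 G (u *m P) (v *m P) = app2 G u v - app1 E u * app1 E v.
Implicit Types (u v z : V).

Lemma app1Z u k : app1 E (k *: u) = k * app1 E u.
Proof. by rewrite /app1 -scalemxAl mxE. Qed.

Lemma app10 : app1 E 0 = 0.
Proof. by rewrite /app1 mul0mx mxE. Qed.

(** Since phi^2 xi = 0, applying phi^2 to phi xi shows that phi xi = c xi; then c^2 xi = phi^2 xi =
    0 forces c xi = 0. *)
Lemma xi_phi : X *m P = 0.
Proof.
have XPP : X *m P *m P = 0 by rewrite PP EX scale1r addNr.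
have := PP (X *m P); rewrite XPP mul0mx => /esym/eqP.
rewrite addrC subr_eq0; move: (app1 _ _) => c /eqP XP.
move: (XPP); rewrite -XP -scalemxAl -XP scalerA => /eqP.
rewrite scaler_eq0 mulf_eq0 orbb => /orP[/eqP -> |/eqP X0]; first by rewrite scale0r.
by rewrite X0 scaler0.
Qed.

Lemma eta_phi u : app1 E (u *m P) = 0.
Proof.
have := PP (u *m P); rewrite (PP u) mulmxDl mulNmx -scalemxAl xi_phi scaler0 addr0.
move=> /eqP; rewrite -subr_eq0 opprD addrA subrr add0r oppr_eq0 => /eqP H.
by have := congr1 (app1 E) H; rewrite app1Z EX mulr1 app10.
Qed.

Lemma app2_xi u : app2 G u X = app1 E u.
Proof.
have := GP u X; rewrite xi_phi app20r EX mulr1 => /esym/eqP.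
by rewrite subr_eq0 => /eqP.
Qed.

Lemma app2_phi u v : app2 G (u *m P) v = - app2 G u (v *m P).
Proof.
have := GP u (v *m P); rewrite PP eta_phi mulr0 subr0 app2Dr app2Nr app2Zr app2_xi eta_phi.
by rewrite mulr0 addr0 => <-; rewrite opprK.
Qed.

Lemma phi_metric : P *m G + G *m P^T = 0.
Proof.
apply: app2_inj => u v; rewrite app2Dm app2_mull app2_mulr app2_phi addNr.
by rewrite /app2 mulmx0 mul0mx mxE.
Qed.

Lemma eta_metric : E = G *m X^T.
Proof.
apply/colP => i; rewrite -[LHS](_ : app1 E (delta_mx 0 i) = _); last first.
  by rewrite /app1 -rowE mxE.
by rewrite -app2_xi /app2 -mulmxA -rowE mxE.
Qed.

Lemma phi_square : P *m P = - 1%:M + G *m X^T *m X.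
Proof.
apply/row_matrixP => i; rewrite !rowE mulmxA PP -eta_metric mulmxDr mulmxN mulmx1.
by rewrite mulmxA [_ *m E]mx11_scalar mul_scalar_mx.
Qed.

Lemma xi_metric : X *m G *m X^T = 1%:M.
Proof. by rewrite [LHS]mx11_scalar -[_ 0 0]/(app2 G X X) app2_xi EX. Qed.

End AlmostContactAlgebra.

(** * From ordinary to covariant derivatives of the structure *)

Section CovariantAlgebra.
Variables (R : realFieldType) (N : nat).
Variables (G P A w D : 'M[R]_N) (X B : 'rV[R]_N).
Hypothesis DG : D = w *m G + G *m w^T.
Let T := A + P *m w - w *m P.
Let S := B + X *m w.

(** [A], [B], [D] stand for the derivatives of phi, xi, g in one direction and [w] for the
    connection matrix, so [T] and [S] are the covariant derivatives of phi and xi. Each lemma of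
    this section takes a differentiated identity of the structure, in which the terms in [w]
    recombine, by [DG] where the metric is involved. *)
Lemma covariant_phi_skew : P *m G + G *m P^T = 0 ->
  A *m G + P *m D + (D *m P^T + G *m A^T) = 0 -> T *m G = - (G *m T^T).
Proof.
move=> /eqP; rewrite addr_eq0 => /eqP PG; rewrite DG /T !(trmxDE, trmxNE) !trmx_mul.
mx_expand; rewrite PG -[w *m P *m G]mulmxA PG; mx_expand => H; mx_entries i j.
have := congr1 (fun M : 'M[R]_N => M i j) H.
by rewrite ?(addmxE, oppmxE, mx0E); lra.
Qed.

Lemma covariant_phi_square : P *m P = - 1%:M + G *m X^T *m X ->
  A *m P + P *m A = 0 + ((D *m X^T + G *m B^T) *m X + G *m X^T *m B) ->
  T *m P + P *m T = G *m S^T *m X + G *m X^T *m S.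
Proof.
move=> PP; rewrite DG /T /S !(trmxDE, trmxNE) !trmx_mul add0r.
mx_expand; rewrite PP -[w *m P *m P]mulmxA PP; mx_expand => H; mx_entries i j.
have := congr1 (fun M : 'M[R]_N => M i j) H.
by rewrite ?(addmxE, oppmxE, mx0E); lra.
Qed.

Lemma covariant_phi_xi : X *m P = 0 -> B *m P + X *m A = 0 -> S *m P + X *m T = 0.
Proof.
move=> XP; rewrite /T /S; mx_expand; rewrite XP mul0mx => H; mx_entries i j.
by have := congr1 (fun M : 'rV[R]_N => M i j) H; rewrite ?(addmxE, oppmxE, mx0E); lra.
Qed.

Lemma covariant_xi_metric : G^T = G ->
  (B *m G + X *m D) *m X^T + X *m G *m B^T = 0 -> (S *m G *m X^T) 0 0 = 0.
Proof.
move=> Gs; rewrite DG /S; mx_expand => H.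
have := congr1 (fun M : 'M[R]_1 => M 0 0) H.
have E1 : (X *m G *m B^T) 0 0 = (B *m G *m X^T) 0 0.
  by rewrite -[in LHS](trmxK (X *m G *m B^T)) mxE !trmx_mul trmxK Gs mulmxA.
have E2 : (X *m G *m w^T *m X^T) 0 0 = (X *m w *m G *m X^T) 0 0.
  by rewrite -[in LHS](trmxK (X *m G *m w^T *m X^T)) mxE !trmx_mul !trmxK Gs !mulmxA.
by rewrite ?(addmxE, oppmxE, mx0E) E1 E2; lra.
Qed.

End CovariantAlgebra.

(** * Normality and closedness in a chart *)

Section ContactChart.
Variables (R : realType) (m : nat) (U : set 'rV[R]_m.+1).
Notation V := 'rV[R]_m.+1.
Hypothesis oU : open U.
Variables (g phi : V -> 'M[R]_m.+1) (xi : V -> V) (eta : V -> 'cV[R]_m.+1).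
Hypothesis sg : smooth_on U g.
Hypothesis sphi : smooth_on U phi.
Hypothesis sxi : smooth_on U xi.
Hypothesis seta : smooth_on U eta.
Hypothesis g_sym : forall x, U x -> (g x)^T = g x.
Hypothesis g_unit : forall x, U x -> g x \in unitmx.
Hypothesis acm : forall x, U x ->
  [/\ forall u, u *m phi x *m phi x = - u + app1 (eta x) u *: xi x,
      app1 (eta x) (xi x) = 1
    & forall u v, app2 (g x) (u *m phi x) (v *m phi x)
                  = app2 (g x) u v - app1 (eta x) u * app1 (eta x) v].
Implicit Types (x y u v w z : V).

Local Notation om := (connection g).

Definition nabla_phi u x : 'M[R]_m.+1 := 'D_u phi x + phi x *m om u x - om u x *m phi x.
Definition nabla_xi u x : V := 'D_u xi x + xi x *m om u x.

Let acm_xi_phi x (Ux : U x) : xi x *m phi x = 0.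
Proof. by have [a b c] := acm Ux; exact: xi_phi a b. Qed.
Let acm_phi_metric x (Ux : U x) : phi x *m g x + g x *m (phi x)^T = 0.
Proof. by have [a b c] := acm Ux; exact: phi_metric a b c. Qed.
Let acm_eta x (Ux : U x) : eta x = g x *m (xi x)^T.
Proof. by have [a b c] := acm Ux; exact: eta_metric a b c. Qed.
Let acm_phi_square x (Ux : U x) :
  phi x *m phi x = - 1%:M + g x *m (xi x)^T *m xi x.
Proof. by have [a b c] := acm Ux; exact: phi_square a b c. Qed.
Let acm_xi_metric x (Ux : U x) : xi x *m g x *m (xi x)^T = 1%:M.
Proof. by have [a b c] := acm Ux; exact: xi_metric a b c. Qed.

Let dg x u (Ux : U x) : is_derive x u g ('D_u g x) := smooth_is_derive u sg Ux.
Let dphi x u (Ux : U x) : is_derive x u phi ('D_u phi x) := smooth_is_derive u sphi Ux.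
Let dxi x u (Ux : U x) : is_derive x u xi ('D_u xi x) := smooth_is_derive u sxi Ux.
Let dxit x u (Ux : U x) := is_derive_trmx (dxi u Ux).

Let derive_open p q (f h : V -> 'M[R]_(p, q)) x u df dh : U x ->
  (forall y, U y -> f y = h y) -> is_derive x u f df -> is_derive x u h dh -> df = dh.
Proof.
move=> Ux E [_ <-] [_ <-]; exact: (derive_open_eq _ oU Ux E).
Qed.

Lemma nabla_phi_skew x u : U x -> nabla_phi u x *m g x = - (g x *m (nabla_phi u x)^T).
Proof.
move=> Ux; apply: (covariant_phi_skew (derive_metric oU sg g_sym g_unit u Ux)).
  exact: acm_phi_metric.
apply: (derive_open Ux acm_phi_metric _ (is_derive_cst 0 x u)).
exact: (is_deriveD (is_derive_mulmx (dphi u Ux) (dg u Ux))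
  (is_derive_mulmx (dg u Ux) (is_derive_trmx (dphi u Ux)))).
Qed.

Lemma nabla_phi_square x u : U x ->
  nabla_phi u x *m phi x + phi x *m nabla_phi u x
  = g x *m (nabla_xi u x)^T *m xi x + g x *m (xi x)^T *m nabla_xi u x.
Proof.
move=> Ux; apply: (covariant_phi_square (derive_metric oU sg g_sym g_unit u Ux)).
  exact: acm_phi_square.
apply: (derive_open Ux acm_phi_square).
  exact: (is_derive_mulmx (dphi u Ux) (dphi u Ux)).
exact: (is_deriveD (is_derive_cst _ x u)
  (is_derive_mulmx (is_derive_mulmx (dg u Ux) (dxit u Ux)) (dxi u Ux))).
Qed.

Lemma nabla_phi_xi x u : U x -> nabla_xi u x *m phi x + xi x *m nabla_phi u x = 0.
Proof.
move=> Ux; apply: covariant_phi_xi; first exact: acm_xi_phi.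
apply: (derive_open Ux acm_xi_phi _ (is_derive_cst 0 x u)).
exact: (is_derive_mulmx (dxi u Ux) (dphi u Ux)).
Qed.

Lemma nabla_xi_metric x u : U x -> app2 (g x) (nabla_xi u x) (xi x) = 0.
Proof.
move=> Ux; apply: (covariant_xi_metric (derive_metric oU sg g_sym g_unit u Ux)).
  exact: g_sym.
apply: (derive_open Ux acm_xi_metric _ (is_derive_cst _ x u)).
exact: (is_derive_mulmx (is_derive_mulmx (dxi u Ux) (dg u Ux)) (dxit u Ux)).
Qed.

Let derive_mul_phi x v w : U x -> 'D_w (endo phi (cst v)) x = v *m 'D_w phi x.
Proof.
move=> Ux; have := is_derive_mulmx (is_derive_cst v x w) (dphi w Ux).
by rewrite mul0mx add0r => -[].
Qed.

(** On constant fields only derivatives of [phi] remain. Completing them to covariant derivatives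
    adds connection terms that cancel in pairs by torsion-freeness. *)
Lemma nijenhuis_cst x u v : U x ->
  nijenhuis phi (cst u) (cst v) x =
  v *m nabla_phi (u *m phi x) x - u *m nabla_phi (v *m phi x) x
  + u *m nabla_phi v x *m phi x - v *m nabla_phi u x *m phi x.
Proof.
move=> Ux.
have E1 : lie (cst u) (cst v) = cst (0 : V).
  by apply/funext => y; rewrite /lie /der !derive_cst subrr.
have E2 : lie (endo phi (cst u)) (endo phi (cst v)) x =
    v *m 'D_(u *m phi x) phi x - u *m 'D_(v *m phi x) phi x.
  exact: (f_equal2 (fun a b : V => a - b) (derive_mul_phi v _ Ux) (derive_mul_phi u _ Ux)).
have E3 : lie (endo phi (cst u)) (cst v) x = - (u *m 'D_v phi x).
  rewrite -[RHS]sub0r.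
  exact: (f_equal2 (fun a b : V => a - b) (derive_cst _ _ _) (derive_mul_phi u _ Ux)).
have E4 : lie (cst u) (endo phi (cst v)) x = v *m 'D_u phi x.
  rewrite -[RHS]subr0.
  exact: (f_equal2 (fun a b : V => a - b) (derive_mul_phi v _ Ux) (derive_cst _ _ _)).
rewrite /nijenhuis E1 E2 /endo /= mul0mx mul0mx add0r.
rewrite (f_equal (mulmx^~ (phi x)) E3) (f_equal (mulmx^~ (phi x)) E4) /nabla_phi.
have S a b := mul_connectionC oU sg g_sym g_unit a b Ux.
have S1 := S (u *m phi x) (v *m phi x); have S2 := S (u *m phi x) v.
have S3 := S (v *m phi x) u; have S4 := S u v.
move: ('D_(u *m _) phi x) ('D_(v *m _) phi x) ('D_u phi x) ('D_v phi x) => A1 A2 A3 A4.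
move: (om (u *m phi x) x) (om (v *m phi x) x) (om u x) (om v x) S1 S2 S3 S4 => a b c d S1 S2 S3 S4.
mx_expand; rewrite S1 S2 S3 S4; mx_entries i j; ring.
Qed.

(** As [eta] is dual to [xi] and the metric is parallel, the derivative of [eta] is expressed
    through [nabla_xi]; torsion-freeness removes the other connection terms. The fields are not
    constant because [closed_one_form] tests all smooth fields. *)
Lemma d1E x (X Y : V -> V) : U x -> derivable X x (Y x) -> derivable Y x (X x) ->
  d1 eta X Y x = 2^-1 * (app2 (g x) (nabla_xi (X x) x) (Y x) - app2 (g x) (nabla_xi (Y x) x) (X x)).
Proof.
move=> Ux dX dY.
have de u : 'D_u eta x = om u x *m eta x + g x *m (nabla_xi u x)^T.
  rewrite (derive_open Ux acm_eta (smooth_is_derive u seta Ux)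
     (is_derive_mulmx (dg u Ux) (dxit u Ux))).
  rewrite (derive_metric oU sg g_sym g_unit u Ux) acm_eta// /nabla_xi trmxDE (trmx_mul (xi x)).
  by mx_expand; mx_entries i j; ring.
have D (Z W : V -> V) : derivable W x (Z x) ->
    der Z (pair1 eta W) x = ('D_(Z x) W x *m eta x + W x *m 'D_(Z x) eta x) 0 0.
  move=> dW.
  by have /is_derive_mxP/(_ 0 0)[_] := is_derive_mulmx (derivableP dW) (smooth_is_derive (Z x) seta Ux).
rewrite /d1; congr (_ * _).
rewrite (D X Y dY) (D Y X dX) !de /pair1 /lie /der /app1 /app2.
have S := mul_connectionC oU sg g_sym g_unit (X x) (Y x) Ux.
have E (a b : V) : (a *m g x *m b^T) 0 0 = (b *m g x *m a^T) 0 0.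
  exact: (app2_symC a b (g_sym Ux)).
move: (nabla_xi (X x) x) (nabla_xi (Y x) x) ('D_(X x) Y x) ('D_(Y x) X x) => a b c d.
move: (om (X x) x) (om (Y x) x) S => p q S.
mx_expand; rewrite S ?(addmxE, oppmxE) -(E (Y x) a) -(E (X x) b); ring.
Qed.

(** Each derivative of the fundamental form is a covariant part plus two connection terms; over the
    cyclic sum the six connection terms cancel by torsion-freeness. *)
Lemma d2_cst x u v z : U x ->
  d2 (fundamental_form g phi) (cst u) (cst v) (cst z) x =
  3^-1 * (app2 (g x) v (z *m nabla_phi u x) + app2 (g x) z (u *m nabla_phi v x)
   + app2 (g x) u (v *m nabla_phi z x)).
Proof.
move=> Ux; have E1 a b c : fundamental_form g phi (lie (cst a) (cst b)) (cst c) x = 0.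
  by rewrite /fundamental_form /pair2 /lie /der !derive_cst subrr app20l.
have gC a b : app2 (g x) a b = app2 (g x) b a by exact: app2_symC (g_sym Ux).
have gP a b : app2 (g x) (a *m phi x) b = - app2 (g x) a (b *m phi x).
  by have [p q r] := acm Ux; exact: app2_phi p q r a b.
have E2 a b c : der (cst a) (fundamental_form g phi (cst b) (cst c)) x =
   app2 (g x) (b *m om a x) (c *m phi x) - app2 (g x) (c *m om a x) (b *m phi x)
   + app2 (g x) b (c *m nabla_phi a x).
  have /is_derive_mxP/(_ 0 0)[_] := is_derive_mulmx (is_derive_mulmx (is_derive_cst b x a) (dg a Ux))
    (is_derive_trmx (is_derive_mulmx (is_derive_cst c x a) (dphi a Ux))).
  rewrite mul0mx add0r mul0mx add0r (derive_metric oU sg g_sym g_unit a Ux) => H.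
  apply: (eq_trans H); rewrite addmxE -/(app2 _ _ _) -/(app2 _ _ _).
  rewrite app2Dm app2_mull app2_mulr /nabla_phi /cst.
  have := gP b (c *m om a x); have := gC (b *m phi x) (c *m om a x).
  move: ('D_a phi x) (om a x) => A w H1 H2.
  by rewrite !mulmxDr mulmxN !mulmxA !app2Dr app2Nr; lra.
rewrite /d2; congr (_ * _).
transitivity (der (cst u) (fundamental_form g phi (cst v) (cst z)) x
  + der (cst v) (fundamental_form g phi (cst z) (cst u)) x
  + der (cst z) (fundamental_form g phi (cst u) (cst v)) x).
  have E0 (r a b c : R) : a = 0 -> b = 0 -> c = 0 -> r - a - b - c = r.
    by move=> -> -> ->; rewrite !subr0.
  exact: E0 (E1 u v z) (E1 v z u) (E1 z u v).
apply: (eq_trans (f_equal2 +%R (f_equal2 +%R (E2 u v z) (E2 v z u)) (E2 z u v))).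
have S a b := mul_connectionC oU sg g_sym g_unit a b Ux.
move: (S u v) (S u z) (S v z); move: (om u x) (om v x) (om z x) => a b c -> -> ->.
have AC (p q r k l n : R) : p - q + k + (r - p + l) + (q - r + n) = k + l + n by ring.
exact: AC.
Qed.

Hypothesis normal : forall x u v, U x ->
  nijenhuis phi (cst u) (cst v) x + (2 * d1 eta (cst u) (cst v) x) *: xi x = 0.
Hypothesis closed : forall x u v z, U x ->
  d2 (fundamental_form g phi) (cst u) (cst v) (cst z) x = 0.

(** This is [contact_identities] for s(u,v) = g(nabla_u xi, v) and t(u;v,z) = g((nabla_u phi) v, z);
    nondegeneracy of [g] turns the vanishing of these forms into that of the covariant
    derivatives. *)
Lemma nabla_identities x : U x ->
  [/\ nabla_xi (xi x) x = 0,
      forall u v, app2 (g x) (nabla_xi u x) v = - app2 (g x) (nabla_xi v x) u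
    & (forall u v, app2 (g x) (nabla_xi u x) v = app2 (g x) (nabla_xi v x) u) ->
      (forall u, nabla_xi u x = 0) /\ (forall u, nabla_phi u x = 0)].
Proof.
move=> Ux; have [PP EX GP] := acm Ux.
have gC a b : app2 (g x) a b = app2 (g x) b a by exact: app2_symC (g_sym Ux).
have XP := acm_xi_phi Ux.
have gP a b : app2 (g x) (a *m phi x) b = - app2 (g x) a (b *m phi x).
  exact: app2_phi PP EX GP a b.
have gX a : app2 (g x) a (xi x) = app1 (eta x) a by exact: app2_xi PP EX GP a.
have T0 : nabla_phi 0 x = 0.
  have o0 : om 0 x = 0 by exact: (connection0 oU sg g_sym g_unit).
  by rewrite /nabla_phi (derive0 phi x) o0 mulmx0 mul0mx subr0 addr0.
have nondeg a : (forall b, app2 (g x) a b = 0) -> a = 0.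
  move=> H; rewrite -(mulmxK (g_unit Ux) a).
  suff -> : a *m g x = 0 by rewrite mul0mx.
  apply/rowP => j; rewrite [RHS]mxE -[RHS](H (delta_mx 0 j)).
  by rewrite /app2 trmx_delta -colE [RHS]mxE.
have tS u v z : app2 (g x) (v *m nabla_phi u x) z = - app2 (g x) (z *m nabla_phi u x) v.
  by rewrite -app2_mull (nabla_phi_skew u Ux) app2Nm app2_mulr gC.
have [||||||||||s0 sk sC] := @contact_identities R V (fun u => u *m phi x) (xi x) (app1 (eta x))
  (fun u v z => app2 (g x) (v *m nabla_phi u x) z) (fun u v => app2 (g x) (nabla_xi u x) v) EX.
- by move=> u v; rewrite PP app2Dr app2Nr app2Zr.
- by move=> u v z; rewrite PP app2Dr app2Nr app2Zr.
- by move=> u v; rewrite XP T0 mulmx0 app20l.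
- by move=> u v; rewrite XP app20r.
- by move=> u; exact: nabla_xi_metric.
- exact: tS.
- move=> u v z /=.
  have := nabla_phi_square u Ux.
  move: (nabla_phi u x) (nabla_xi u x) => T S /(congr1 (fun M => app2 (g x) (v *m M) z)).
  rewrite /= !mulmxDr !mulmxA !mul_app2 !app2Dl !app2Zl gP [app2 _ v S]gC.
  by rewrite gX [app2 _ (xi x) z]gC gX; lra.
- move=> u v; have := nabla_phi_xi u Ux => /eqP; rewrite addrC addr_eq0 => /eqP ->.
  by rewrite app2Nl gP opprK.
- move=> u v z /=.
  have D1 : 2 * d1 eta (cst u) (cst v) x
      = app2 (g x) (nabla_xi u x) v - app2 (g x) (nabla_xi v x) u.
    by rewrite (d1E Ux (derivable_cst _ _ _) (derivable_cst _ _ _)) mulrA divff// mul1r.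
  have := normal u v Ux; rewrite nijenhuis_cst// D1.
  move: (nabla_xi u x) (nabla_xi v x) => a b.
  move: (nabla_phi _ x) (nabla_phi _ x) (nabla_phi u x) (nabla_phi v x) => A B C D.
  move=> /(congr1 (fun a => app2 (g x) a z)) /=.
  by rewrite !app2Dl !app2Nl app2Zl app20l !gP [app2 _ (xi x) z]gC gX; lra.
- move=> u v z; have := closed u v z Ux.
  rewrite d2_cst// => /eqP; rewrite mulf_eq0 invr_eq0 pnatr_eq0/= => /eqP.
  rewrite gC [app2 _ z (u *m _)]gC [app2 _ u (v *m _)]gC.
  have := tS u v z; have := tS v z u; have := tS z u v.
  by move: (nabla_phi u x) (nabla_phi v x) (nabla_phi z x) => A B C; lra.
split.
- by apply: nondeg => b; rewrite s0.
- exact: sk.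
- move=> /sC[s00 t0]; split=> u; first exact: nondeg.
  apply/row_matrixP => i; rewrite rowE row0; exact: nondeg.
Qed.

End ContactChart.

(** * Ricci curvature *)

Section Cholesky.
Variable R : rcfType.

(** Symmetric Gauss elimination: [L] clears the off-diagonal blocks, leaving the pivot [a] and the
    Schur complement [s], to which the induction hypothesis applies. *)
Lemma cholesky n (G : 'M[R]_n) : G^T = G ->
  (forall u : 'rV[R]_n, u != 0 -> 0 < (u *m G *m u^T) 0 0) ->
  exists2 Q : 'M[R]_n, Q \in unitmx & Q *m G *m Q^T = 1%:M.
Proof.
elim: n G => [|n IH] G Gs Gp.
  by exists 1%:M; [exact: unitmx1|apply/matrixP => -[]].
move: (G : 'M[R]_(1 + n)) Gs Gp => {}G Gs Gp.
have {}Gp : forall u : 'rV[R]_(1 + n), u != 0 -> 0 < (u *m G *m u^T) 0 0 := Gp.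
change (exists2 Q : 'M[R]_(1 + n), Q \in unitmx & Q *m G *m Q^T = 1%:M).
have e0 : row_mx (1%:M : 'M[R]_1) (0 : 'rV[R]_n) != 0.
  apply/eqP => /(congr1 lsubmx); rewrite row_mxKl lsubmx_const => /matrixP/(_ 0 0)/eqP.
  by rewrite !mxE eqxx oner_eq0.
pose a := ulsubmx G; pose b := ursubmx G; pose d := drsubmx G.
have bT : dlsubmx G = b^T by rewrite /b trmx_ursub Gs.
have dT : d^T = d by rewrite /d trmx_drsub Gs.
have aT : a^T = a by rewrite /a trmx_ulsub Gs.
have GE : G = block_mx a b b^T d by rewrite -bT submxK.
have a0 : 0 < a 0 0.
  have := Gp _ e0; rewrite GE mul_row_block !mul1mx !mul0mx !addr0.
  by rewrite tr_row_mx mul_row_col trmx1 mulmx1 trmx0 mulmx0 addr0.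
have aE : a = (a 0 0)%:M by rewrite [LHS]mx11_scalar.
pose k := (a 0 0)^-1.
pose L : 'M[R]_(1 + n) := block_mx 1%:M 0 (- k *: b^T) 1%:M.
have Lu : L \in unitmx by rewrite unitmxE det_lblock !det1 mulr1 unitr1.
pose s := d - k *: (b^T *m b).
have LGL : L *m G *m L^T = block_mx a 0 0 s.
  rewrite GE /L mulmx_block tr_block_mx mulmx_block !mul1mx !mul0mx !addr0 !trmx0 !trmx1.
  rewrite !mulmx0 !mulmx1 !addr0.
  have bk : - k *: b^T *m a + b^T = 0.
    by rewrite aE mul_mx_scalar scalerA mulrN /k divff ?gt_eqF// scaleN1r addNr.
  rewrite bk mul0mx add0r.
  congr (block_mx _ _ _ _).
    rewrite linearZ /= trmxK aE mul_scalar_mx scalerA mulrN divff ?gt_eqF//.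
    by rewrite scaleN1r addNr.
  by rewrite -scalemxAl scaleNr addrC.
(* The value of [s] at [u] is that of [G] at [row_mx 0 u *m L], which is nonzero because [L] is
   invertible. *)
have sp (u : 'rV[R]_n) : u != 0 -> 0 < (u *m s *m u^T) 0 0.
  move=> u0; have v0 : row_mx 0 u *m L != 0.
    apply: contra u0 => /eqP H; have := congr1 (mulmx^~ (invmx L)) H.
    by rewrite /= mulmxK// mul0mx => /(congr1 rsubmx); rewrite row_mxKr linear0 => ->.
  have := Gp _ v0; rewrite trmx_mul !mulmxA -[_ *m L *m G]mulmxA -[_ *m (L *m G) *m L^T]mulmxA.
  rewrite LGL mul_row_block !mul0mx !mulmx0 !add0r.
  by rewrite tr_row_mx mul_row_col mul0mx add0r.
have sT : s^T = s by rewrite /s linearB linearZ /= trmx_mul trmxK dT.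
have [Q Qu QsQ] := IH s sT sp.
pose D : 'M[R]_(1 + n) := block_mx (Num.sqrt k)%:M 0 0 Q.
exists (D *m L).
  rewrite unitmx_mul Lu andbT unitmxE det_lblock det_scalar1 unitrM -unitmxE Qu andbT.
  by rewrite unitfE gt_eqF// sqrtr_gt0 invr_gt0.
rewrite trmx_mul !mulmxA -[D *m L *m G]mulmxA -[D *m (L *m G) *m _]mulmxA LGL.
rewrite /D tr_block_mx !mulmx_block !(mulmx0, mul0mx, trmx0, addr0, add0r) QsQ.
rewrite tr_scalar_mx aE -!scalar_mxM mulrAC -expr2 sqr_sqrtr ?invr_ge0 ?ltW//.
by rewrite mulVf ?gt_eqF// -scalar_mx_block.
Qed.

(** In a [G]-orthonormal basis [S] becomes a skew matrix [K], and the trace of [K *m K] is minus the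
    sum of the squares of its entries. *)
Lemma skew_trace_square n (G S : 'M[R]_n) : G^T = G ->
  (forall u : 'rV[R]_n, u != 0 -> 0 < (u *m G *m u^T) 0 0) ->
  S *m G = - (G *m S^T) -> \tr (S *m S) = 0 -> S = 0.
Proof.
move=> Gs Gp SG tr0; have [Q Qu QGQ] := cholesky Gs Gp.
have QV : invmx Q = G *m Q^T.
  by rewrite -[RHS](mulKmx Qu) [Q *m _]mulmxA QGQ mulmx1.
pose K := Q *m S *m invmx Q.
have KT : K^T = - K.
  rewrite /K QV !trmx_mul trmxK Gs -!mulmxA [S *m _]mulmxA SG mulNmx mulmxN opprK.
  by rewrite !mulmxA.
have : \tr (K *m K) = 0.
  rewrite /K -!mulmxA mulKmx// mxtrace_mulC -!mulmxA mulVmx// mulmx1 //.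
rewrite -[X in K *m X]opprK -KT mulmxN raddfN/= => /eqP; rewrite oppr_eq0 => /eqP KK.
have K0 : K = 0.
  have : \sum_i \sum_j K i j ^+ 2 = 0.
    rewrite -[RHS]KK; apply: eq_bigr => i _; rewrite mxE; apply: eq_bigr => j _.
    by rewrite [K^T _ _]mxE expr2.
  move/eqP; rewrite psumr_eq0; last by move=> i _; apply: sumr_ge0 => j _; exact: sqr_ge0.
  move/allP => H; apply/matrixP => i j; have := H i (mem_index_enum _).
  rewrite psumr_eq0; last by move=> ? _; exact: sqr_ge0.
  by move/allP/(_ j (mem_index_enum _)); rewrite sqrf_eq0 [RHS]mxE => /eqP.
by rewrite -[S](mulKmx Qu) -[Q *m S](mulmxKV Qu) -/K K0 mul0mx mulmx0.
Qed.

End Cholesky.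

(** * Ricci curvature in the presence of parallel structures *)

Section RicciAlgebra.
Variables (R : realFieldType) (m : nat).
Notation V := 'rV[R]_m.+1.
Variable Rm : V -> V -> 'M[R]_m.+1.
Hypothesis RmC : forall w u, Rm w u = - Rm u w.
Hypothesis bianchi : forall u v w, v *m Rm w u + w *m Rm u v + u *m Rm v w = 0.
Hypothesis Rm_trace0 : forall w u, \tr (Rm w u) = 0.
Implicit Types (u v w : V) (P Q J : 'M[R]_m.+1) (X : V) (E : 'cV[R]_m.+1).

Definition ric u v : R := \sum_i (v *m Rm (delta_mx 0 i) u) 0 i.

Definition commutes_Rm J := forall w u, Rm w u *m J = J *m Rm w u.

Lemma mxtrace_delta (A : 'M[R]_m.+1) : \tr A = \sum_i ((delta_mx 0 i : V) *m A) 0 i.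
Proof. by apply: eq_bigr => i _; rewrite -rowE mxE. Qed.

Lemma ricD u a b : ric u (a + b) = ric u a + ric u b.
Proof. by rewrite -big_split; apply: eq_bigr => i _; rewrite mulmxDl mxE. Qed.

Lemma ricZ u k a : ric u (k *: a) = k * ric u a.
Proof. by rewrite mulr_sumr; apply: eq_bigr => i _; rewrite -scalemxAl mxE. Qed.

Lemma ricN u a : ric u (- a) = - ric u a.
Proof. by rewrite -scaleN1r ricZ mulN1r. Qed.

Lemma ric_kill u X : (forall w u, X *m Rm w u = 0) -> ric u X = 0.
Proof. by move=> H; apply: big1 => i _; rewrite H mxE. Qed.

(** Multiply the Bianchi identity for [u], [v] and a basis vector by [J] and trace: commuting [J]
    with the curvature produces the two Ricci terms, and the middle term is a trace assumed to
    vanish. [J = 1] yields the symmetry [ricC]. *)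
Lemma ric_commutes J u v : commutes_Rm J -> (forall w u, \tr (Rm w u *m J) = 0) ->
  ric u (v *m J) = ric v (u *m J).
Proof.
move=> cJ tJ; have : ric u (v *m J) + \tr (Rm u v *m J) - ric v (u *m J) = 0.
  rewrite mxtrace_delta /ric -sumrN -!big_split /=; apply: big1 => i _.
  have := congr1 (fun A => (A *m J) 0 i) (bianchi u v (delta_mx 0 i)).
  rewrite /= [Rm v _]RmC !mulmxDl mulmxN mulNmx mul0mx -!mulmxA !cJ.
  by rewrite ?(addmxE, oppmxE, mx0E).
by rewrite tJ; lra.
Qed.

Lemma ricC u v : ric u v = ric v u.
Proof.
by rewrite -[v in LHS]mulmx1 -[u in RHS]mulmx1; apply: ric_commutes => w z; rewrite mulmx1 ?mul1mx.
Qed.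

Lemma trace_rank1 X E w u : (forall w u, X *m Rm w u = 0) -> \tr (Rm w u *m (E *m X)) = 0.
Proof. by move=> H; rewrite mulmxA mxtrace_mulC mulmxA H mul0mx mxtrace0. Qed.

(** Compute tr(R P Q Q) twice. By the square of [Q] it is - tr(R P); moving one [Q] cyclically past
    R and [P] shows that it is its own opposite. The rank-one corrections contribute nothing, since
    R kills the vectors that span their images. *)
Lemma trace_anticommuting P Q X X' X'' E E' E'' :
  commutes_Rm P -> commutes_Rm Q ->
  (forall w u, X *m Rm w u = 0) -> (forall w u, X' *m Rm w u = 0) ->
  (forall w u, X'' *m Rm w u = 0) ->
  Q *m Q = - 1%:M + E *m X -> P *m Q + Q *m P = E' *m X' + E'' *m X'' ->
  forall w u, \tr (Rm w u *m P) = 0.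
Proof.
move=> cP cQ X0 X0' X0'' QQ PQ w u.
have kill (Y : V) (F : 'cV[R]_m.+1) A : (forall w u, Y *m Rm w u = 0) -> \tr (Rm w u *m A *m (F *m Y)) = 0.
  by move=> H; rewrite mulmxA mxtrace_mulC !mulmxA H !mul0mx mxtrace0.
have QP : Q *m P = E' *m X' + E'' *m X'' - P *m Q by rewrite -PQ addrAC subrr add0r.
have tE : \tr (Rm w u *m P *m Q *m Q) = - \tr (Rm w u *m P).
  by rewrite -[_ *m Q *m Q]mulmxA QQ mulmxDr mulmxN mulmx1 mxtraceD (kill _ _ P X0) addr0 raddfN.
have killQ (Y : V) (F : 'cV[R]_m.+1) : (forall w u, Y *m Rm w u = 0) -> \tr (Rm w u *m (F *m Y) *m Q) = 0.
  by move=> H; rewrite mxtrace_mulC [Q *m _]mulmxA -cQ kill.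
have tF : \tr (Rm w u *m P *m Q *m Q) = - \tr (Rm w u *m P *m Q *m Q).
  rewrite [LHS]mxtrace_mulC !mulmxA -cQ -[_ *m Q *m P]mulmxA QP !mulmxDr !mulmxDl !mxtraceD.
  by rewrite (killQ _ _ X0') (killQ _ _ X0'') !add0r mulmxN mulNmx raddfN/= !mulmxA.
lra.
Qed.

(** The two expressions for [J] give tr(R P Q) and - tr(R Q P), and cyclicity with [commutes_Rm P]
    identifies tr(R Q P) with tr(R P Q). *)
Lemma trace_product P Q J X X' E E' : commutes_Rm P ->
  (forall w u, X *m Rm w u = 0) -> (forall w u, X' *m Rm w u = 0) ->
  J = P *m Q - E *m X -> J = - (Q *m P) + E' *m X' ->
  forall w u, \tr (Rm w u *m J) = 0.
Proof.
move=> cP X0 X0' J1 J2 w u.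
have t1 : \tr (Rm w u *m J) = \tr (Rm w u *m P *m Q).
  by rewrite J1 mulmxDr mulmxN mxtraceD raddfN/= trace_rank1// oppr0 addr0 mulmxA.
have t2 : \tr (Rm w u *m J) = - \tr (Rm w u *m P *m Q).
  rewrite J2 mulmxDr mulmxN mxtraceD raddfN/= trace_rank1// addr0 mulmxA mxtrace_mulC.
  by rewrite mulmxA -cP.
lra.
Qed.

Variables (P0 P1 P2 : 'M[R]_m.+1) (X0 X1 X2 : V) (E0 E1 E2 : 'cV[R]_m.+1).
Hypothesis c0 : commutes_Rm P0.
Hypothesis c1 : commutes_Rm P1.
Hypothesis c2 : commutes_Rm P2.
Hypothesis k0 : forall w u, X0 *m Rm w u = 0.
Hypothesis k1 : forall w u, X1 *m Rm w u = 0.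
Hypothesis k2 : forall w u, X2 *m Rm w u = 0.
Hypothesis sq0 : P0 *m P0 = - 1%:M + E0 *m X0.
Hypothesis sq1 : P1 *m P1 = - 1%:M + E1 *m X1.
Hypothesis sq2 : P2 *m P2 = - 1%:M + E2 *m X2.
Hypothesis P2l : P2 = P1 *m P0 - E1 *m X0.
Hypothesis P2r : P2 = - (P0 *m P1) + E0 *m X1.

Lemma ric_rank1 u v E X : (forall w u, X *m Rm w u = 0) -> ric u (v *m (E *m X)) = 0.
Proof. by move=> H; rewrite mulmxA [v *m E]mx11_scalar mul_scalar_mx ricZ ric_kill// mulr0. Qed.

Lemma ric_hyperkahler u v : ric u v = 0.
Proof.
have anti : P1 *m P0 + P0 *m P1 = E1 *m X0 + E0 *m X1.
  have -> : P1 *m P0 = P2 + E1 *m X0 by rewrite P2l addrNK.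
  by rewrite P2r addrAC [_ + E0 *m X1 + _]addrC addrA addrN add0r addrC.
have t0 := trace_anticommuting c0 c1 k1 k0 k1 sq1 (etrans (addrC _ _) anti).
have t1 := trace_anticommuting c1 c0 k0 k0 k1 sq0 anti.
have t2 := trace_product c1 k0 k1 P2l P2r.
(* Moving [P0] and then [P1] to the other argument reverses their order, which by [P2r] gives
   [- ric b (a *m P2)]; moving [P2] as a whole gives [ric b (a *m P2)]. *)
have r2 a b : ric a (b *m P2) = 0.
  have e1 : ric a (b *m P2) = ric b (a *m P0 *m P1).
    rewrite {1}P2l mulmxDr mulmxN ricD ricN ric_rank1// subr0 mulmxA.
    by rewrite (ric_commutes _ _ c0 t0) ricC (ric_commutes _ _ c1 t1).
  have e2 : ric b (a *m P2) = - ric b (a *m P0 *m P1).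
    by rewrite {1}P2r mulmxDr mulmxN ricD ricN ric_rank1// addr0 mulmxA.
  by have e3 := ric_commutes a b c2 t2; lra.
(* Up to a multiple of [X2], which the curvature kills, [v] lies in the image of [P2]. *)
have vE : v = v *m (E2 *m X2) - v *m P2 *m P2.
  by rewrite -mulmxA sq2 mulmxDr mulmxN mulmx1 opprD opprK addrC addrNK.
by rewrite vE ricD ricN r2 ric_rank1// subr0.
Qed.

End RicciAlgebra.

(** [h] and [k] stand for the two mixed second derivatives of xi; once they are identified, what
    remains is the Ricci identity for xi. *)
Lemma commute_second_derivatives (R : comNzRingType) N (X p q h k sp sq : 'rV[R]_N)
    (a b c d : 'M[R]_N) :
  sp = h + (p *m a + X *m c) -> sq = k + (q *m b + X *m d) -> h = k ->
  X *m (c - d + a *m b - b *m a)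
  = sp - sq - (p + X *m b) *m a + (q + X *m a) *m b.
Proof. by move=> -> -> ->; mx_expand; mx_entries i j; ring. Qed.

(** * Ricci curvature along a geodesic Killing field *)

Section KillingRicci.
Variables (R : realType) (m : nat) (U : set 'rV[R]_m.+1).
Notation V := 'rV[R]_m.+1.
Hypothesis oU : open U.
Variables (g : V -> 'M[R]_m.+1) (xi : V -> V).
Hypothesis sg : smooth_on U g.
Hypothesis sxi : smooth_on U xi.
Hypothesis g_sym : forall x, U x -> (g x)^T = g x.
Hypothesis g_unit : forall x, U x -> g x \in unitmx.
Hypothesis g_pos : forall (x u : V), U x -> u != 0 -> 0 < app2 (g x) u u.
Implicit Types (x y u v w z : V).
Local Notation om := (connection g).
Local Notation nxi := (nabla_xi g xi).

Definition nabla_xi_mx x : 'M[R]_m.+1 := \matrix_i nxi (delta_mx 0 i) x.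
Local Notation S := nabla_xi_mx.

(** Torsion-freeness moves [u] from the index of the connection matrix to the vector slot, where
    linearity is visible. *)
Lemma mul_nabla_xi_mx x u : U x -> u *m S x = nxi u x.
Proof.
move=> Ux.
have E a : nxi a x = 'D_a xi x + a *m om (xi x) x.
  exact: (f_equal (fun b => 'D_a xi x + b) (mul_connectionC oU sg g_sym g_unit a (xi x) Ux)).
apply: (mul_rows_delta (f := fun u => nxi u x)) => [a b|k a]; rewrite !E.
  by rewrite (smooth_deriveDv oU a b sxi Ux) mulmxDl addrACA.
by rewrite (smooth_deriveZv oU k a sxi Ux) -scalemxAl scalerDr.
Qed.

Lemma is_derive_nabla_xi x u w : U x -> is_derive x w (nxi u)
  ('D_w ('D_u xi) x + ('D_w xi x *m om u x + xi x *m 'D_w (om u) x)).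
Proof.
move=> Ux; apply: (is_deriveD (smooth_is_derive w (smooth_derive u sxi) Ux)).
exact: (is_derive_mulmx (smooth_is_derive w sxi Ux) (is_derive_connection oU sg g_unit u w Ux)).
Qed.

Lemma derivable_nabla_xi_mx x w : U x -> derivable S x w.
Proof.
move=> Ux; apply/derivable_mxP => i j.
have /is_derive_mxP/(_ 0 j)[d _] := is_derive_nabla_xi (delta_mx 0 i) w Ux.
by under eq_fun do rewrite mxE; exact: d.
Qed.

Lemma derive_nabla_xi x u w : U x ->
  u *m 'D_w S x = 'D_w ('D_u xi) x + ('D_w xi x *m om u x + xi x *m 'D_w (om u) x).
Proof.
move=> Ux; have [_ <-] := is_derive_nabla_xi u w Ux.
have dS := derivableP (derivable_nabla_xi_mx (w := w) Ux).
have [_] := is_derive_mulmx (is_derive_cst u x w) dS.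
rewrite mul0mx add0r => <-.
by apply: (derive_open_eq _ oU Ux) => y Uy; exact: mul_nabla_xi_mx.
Qed.

Lemma xi_curvature x u w : U x ->
  xi x *m curvature_mx g w u x =
  u *m 'D_w S x - w *m 'D_u S x - nxi w x *m om u x + nxi u x *m om w x.
Proof.
move=> Ux; exact: (commute_second_derivatives (derive_nabla_xi u w Ux)
  (derive_nabla_xi w u Ux) (smooth_derive_commute oU u w sxi Ux)).
Qed.

Hypothesis nxi_skew : forall x u v, U x ->
  app2 (g x) (nxi u x) v = - app2 (g x) (nxi v x) u.
Hypothesis nxi_geodesic : forall x, U x -> nxi (xi x) x = 0.

Lemma nabla_xi_mx_skew x : U x -> S x *m g x = - (g x *m (S x)^T).
Proof.
move=> Ux; apply: app2_inj => u v.
rewrite app2Nm app2_mull app2_mulr !mul_nabla_xi_mx// nxi_skew//.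
by rewrite (app2_symC _ _ (g_sym Ux)).
Qed.

(** Differentiating [xi y *m S y = 0] eliminates the term [xi x *m 'D_w S x], so R(w,xi)xi becomes
    [w *m Q] for a single matrix [Q]. In its trace the two connection terms cancel by cyclicity, and
    the derivative of [S] is traceless because [S] is skew for [g] all over [U]. *)
Lemma ricci_xi x : U x -> ricci g x (xi x) (xi x) = - \tr (S x *m S x).
Proof.
move=> Ux; rewrite (ricciE oU sg g_sym g_unit)//.
have S0 y : U y -> xi y *m S y = 0 by move=> Uy; rewrite mul_nabla_xi_mx// nxi_geodesic.
have trS y : U y -> \tr (S y) = 0.
  by move=> Uy; exact: mxtrace_skew (g_unit Uy) (nabla_xi_mx_skew Uy).
have dS w : is_derive x w S ('D_w S x) by apply: derivableP; exact: derivable_nabla_xi_mx.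
have trDS w : \tr ('D_w S x) = 0.
  have [_ <-] := is_derive_mxtrace (dS w).
  rewrite -(derive_cst (0 : R) x w); apply: near_eq_derive.
  by apply: (near_open oU) => // y Uy; exact: trS.
have DS w : xi x *m 'D_w S x = - ('D_w xi x *m S x).
  have [_ E1] := is_derive_mulmx (smooth_is_derive w sxi Ux) (dS w).
  have E2 : 'D_w (fun y => xi y *m S y) x = 0.
    rewrite -(derive_cst (0 : V) x w); exact: (derive_open_eq _ oU Ux S0).
  by apply/eqP; rewrite -addr_eq0 addrC -E1 E2.
have Dxi w : 'D_w xi x = w *m S x - w *m om (xi x) x.
  rewrite mul_nabla_xi_mx// (mul_connectionC oU sg g_sym g_unit (xi x) w Ux).
  by rewrite /nabla_xi addrK.
pose Q := - (S x *m S x) + om (xi x) x *m S x - 'D_(xi x) S x - S x *m om (xi x) x.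
have E w : xi x *m curvature_mx g w (xi x) x = w *m Q.
  rewrite xi_curvature// DS Dxi nxi_geodesic// mul0mx addr0 -mul_nabla_xi_mx// /Q.
  move: (S x) (om (xi x) x) ('D_(xi x) S x) => A B D.
  by mx_expand; mx_entries i j; ring.
rewrite (eq_bigr (fun i => ((delta_mx 0 i : V) *m Q) 0 i)); last by move=> i _; rewrite E.
rewrite -mxtrace_delta /Q !mxtraceD !(raddfN mxtrace) /= trDS [\tr (om _ _ *m _)]mxtrace_mulC.
by rewrite oppr0 addr0 addrK.
Qed.

(** Ric(xi,xi) is minus the trace of the square of the skew endomorphism [S], so it vanishes only if
    [S] does. *)
Lemma ricci_flat_parallel x u : U x -> ricci g x (xi x) (xi x) = 0 -> nxi u x = 0.
Proof.
move=> Ux; rewrite ricci_xi// => /eqP; rewrite oppr_eq0 => /eqP tr0.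
rewrite -mul_nabla_xi_mx// (skew_trace_square (g_sym Ux) _ (nabla_xi_mx_skew Ux) tr0) ?mulmx0//.
by move=> v v0; exact: g_pos.
Qed.

End KillingRicci.

(** * Structures on the manifold, chart by chart *)

Section Charts.
Variables (R : realType) (m : nat) (M : smooth_manifold R m).
Notation V := 'rV[R]_m.+1.
Variables (phi : endo_field M) (xi : vector_field M) (eta : one_form M)
  (g : riemannian_metric M).

Lemma open_img (i : chart M) : open (img i).
Proof. exact: (@img_open _ _ M i). Qed.

Lemma metric_sym i x : img i x -> (g i x)^T = g i x.
Proof. by move=> ix; apply: app2_inj => a b; rewrite app2_tr rm_sym. Qed.

Lemma metric_unit i x : img i x -> g i x \in unitmx.
Proof.
move=> ix; rewrite -row_free_unit -kermx_eq0; apply: contraT => /rowV0Pn[v /sub_kermxP vg v0].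
by have := rm_posdef g ix v0; rewrite /app2 vg mul0mx mxE ltxx.
Qed.

Lemma chart_nabla_identities : almost_contact_metric phi xi eta g ->
  normal_structure phi xi eta -> closed_fundamental_form phi g ->
  forall i x, img i x ->
  [/\ nabla_xi (g i) (xi i) (xi i x) x = 0,
      forall u v, app2 (g i x) (nabla_xi (g i) (xi i) u x) v
                  = - app2 (g i x) (nabla_xi (g i) (xi i) v x) u
    & (forall u v, app2 (g i x) (nabla_xi (g i) (xi i) u x) v
                   = app2 (g i x) (nabla_xi (g i) (xi i) v x) u) ->
      (forall u, nabla_xi (g i) (xi i) u x = 0) /\
      (forall u, nabla_phi (g i) (phi i) u x = 0)].
Proof.
move=> acm nor clo i x ix.
apply: (nabla_identities (@open_img i) (rm_smooth g i) (ef_smooth phi i) (vf_smooth xi i)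
  (of_smooth eta i) (@metric_sym i) (@metric_unit i) (acm i) _ _ ix).
- by move=> y u v iy; apply: nor => //; exact: smooth_cst.
- by move=> y u v z iy; apply: clo => //; exact: smooth_cst.
Qed.

Lemma chart_d1E i x (X Y : V -> V) : almost_contact_metric phi xi eta g -> img i x ->
  smooth_on (img i) X -> smooth_on (img i) Y ->
  d1 (eta i) X Y x = 2^-1 * (app2 (g i x) (nabla_xi (g i) (xi i) (X x) x) (Y x)
                             - app2 (g i x) (nabla_xi (g i) (xi i) (Y x) x) (X x)).
Proof.
move=> acm ix sX sY.
apply: (d1E (@open_img i) (rm_smooth g i) (vf_smooth xi i) (of_smooth eta i)
  (@metric_sym i) (@metric_unit i) (acm i) ix).
- exact: smooth_derivable sX ix.
- exact: smooth_derivable sY ix.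
Qed.

(** Once xi is parallel, d eta = 0 by [chart_d1E]; the other clauses are shared by the two
    notions. *)
Lemma quasi_sasakian_ricci_flat : quasi_sasakian phi xi eta g -> ricci_flat g ->
  cosymplectic phi xi eta g.
Proof.
move=> [acm nor clo _] rf; split=> // i X Y sX sY x ix.
have K y (iy : img i y) := chart_nabla_identities acm nor clo iy.
have P u : nabla_xi (g i) (xi i) u x = 0.
  apply: (ricci_flat_parallel (@open_img i) (rm_smooth g i) (vf_smooth xi i)
    (@metric_sym i) (@metric_unit i) _ _ _ u ix (rf i x ix _ _)).
  - by move=> y v iy; exact: rm_posdef.
  - by move=> y u' v iy; have [] := K y iy.
  - by move=> y iy; have [] := K y iy.
by rewrite chart_d1E// !P !app20l subrr mulr0.
Qed.

(** On constant fields d eta = 0 says that g(nabla_u xi, v) is symmetric, the premise of the last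
    clause of [chart_nabla_identities]. *)
Lemma cosymplectic_parallel : cosymplectic phi xi eta g -> forall i x, img i x ->
  (forall u, nabla_xi (g i) (xi i) u x = 0) /\ (forall u, nabla_phi (g i) (phi i) u x = 0).
Proof.
move=> [acm nor clo eclo] i x ix.
have [_ _] := chart_nabla_identities acm nor clo ix; apply=> u v.
have := eclo i (cst u) (cst v) (smooth_cst _ _) (smooth_cst _ _) x ix.
rewrite chart_d1E//; try exact: smooth_cst.
by move=> /eqP; rewrite mulf_eq0 invr_eq0 pnatr_eq0/= subr_eq0 => /eqP.
Qed.

Lemma cosymplectic_curvature : cosymplectic phi xi eta g -> forall i x w u, img i x ->
  xi i x *m curvature_mx (g i) w u x = 0 /\
  curvature_mx (g i) w u x *m phi i x = phi i x *m curvature_mx (g i) w u x.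
Proof.
move=> cos i x w u ix; split.
  apply: (curvature_kill (@open_img i) (rm_smooth g i) (@metric_unit i) (X := xi i) _ _ (vf_smooth xi i)) => // v y iy.
  have [/(_ v) H _] := cosymplectic_parallel cos iy.
  by apply/eqP; rewrite -addr_eq0; apply/eqP.
apply: (curvature_commute (@open_img i) (rm_smooth g i) (@metric_unit i) (X := phi i) _ _ (ef_smooth phi i)) => // v y iy.
have [_ /(_ v) H] := cosymplectic_parallel cos iy.
apply/eqP; rewrite -subr_eq0 opprB addrA; apply/eqP; exact: H.
Qed.

Lemma acm_matrix_square : almost_contact_metric phi xi eta g -> forall i x, img i x ->
  phi i x *m phi i x = - 1%:M + eta i x *m xi i x.
Proof.
move=> acm i x ix; have [PP EX GP] := acm i x ix.
by rewrite (phi_square PP EX GP) -(eta_metric PP EX GP).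
Qed.

End Charts.

Theorem corollary3p8 (R : realType) (n : nat)
  (M : smooth_manifold R (4 * n).+2)
  (phi : 'I_3 -> endo_field M) (xi : 'I_3 -> vector_field M)
  (eta : 'I_3 -> one_form M) (g : riemannian_metric M)
  (h3qs : three_quasi_sasakian phi xi eta g) :
  ricci_flat g <-> three_cosymplectic phi xi eta g.
Proof.
have [[acm perm3] qs] := h3qs; split=> [rf|[_ cos] i x ix u v].
  by split=> // a; exact: quasi_sasakian_ricci_flat.
rewrite (ricciE (@open_img _ _ M i) (rm_smooth g i) (@metric_sym _ _ _ g i) (@metric_unit _ _ _ g i) _ _ ix).
pose a0 : 'I_3 := 0; pose a1 : 'I_3 := 1; pose a2 : 'I_3 := 2.
have C a := cosymplectic_curvature (cos a).
(* The identity permutation is even; of its relations the two expressions for the third [phi] are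
   kept, which are the quaternionic relations [P2l] and [P2r]. *)
have := perm3 (1%g : 'S_3); rewrite odd_perm1 !perm1 => /(_ isT i x ix)[J1 J2 _ _ _].
apply: (@ric_hyperkahler _ _ (fun w u => curvature_mx (g i) w u x) _ _ _
  (phi a0 i x) (phi a1 i x) (phi a2 i x) (xi a0 i x) (xi a1 i x) (xi a2 i x)
  (eta a0 i x) (eta a1 i x) (eta a2 i x)).
- by move=> w z; exact: curvature_mxC.
- move=> w z t; exact: (curvature_bianchi (@open_img _ _ M i) (rm_smooth g i) (@metric_sym _ _ _ g i) (@metric_unit _ _ _ g i)).
- move=> w z; exact: (curvature_trace0 (@open_img _ _ M i) (rm_smooth g i) (@metric_sym _ _ _ g i) (@metric_unit _ _ _ g i)).
- by move=> w z; have [] := C a0 i x w z ix.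
- by move=> w z; have [] := C a1 i x w z ix.
- by move=> w z; have [] := C a2 i x w z ix.
- by move=> w z; have [] := C a0 i x w z ix.
- by move=> w z; have [] := C a1 i x w z ix.
- by move=> w z; have [] := C a2 i x w z ix.
- exact: acm_matrix_square (acm a0) _ _ ix.
- exact: acm_matrix_square (acm a1) _ _ ix.
- exact: acm_matrix_square (acm a2) _ _ ix.
- by apply/row_matrixP => j; rewrite !rowE J1 mulmxBr mul_rank1 mulmxA.
- by apply/row_matrixP => j; rewrite !rowE J2 mulmxDr mulmxN mul_rank1 mulmxA.
Qed.
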